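(* The Interval Graph Completion problem is solvable in polynomial time when the input graph is the complement $\overline{L(G)}$ of the line graph of a graph $G$ (given $G$): one can compute in time polynomial in $|V(G)|$ an interval-completion of $\overline{L(G)}$ with the minimum possible number of edges.
   Context: Graphs are simple. The line graph $L(G)$ has vertex set $E(G)$, two edges adjacent iff they share an endpoint; $\overline{H}$ is the complement of $H$. An interval graph is the intersection graph of a finite family of closed real intervals. An interval-completion of $H$ is an interval graph on the vertex set of $H$ containing $H$ as a subgraph. The Interval Graph Completion (IGC) problem asks, for a given graph $H$, for an interval-completion of $H$ with the minimum number of edges. *)

(* Defs.v *)
From mathcomp Require Import all_boot all_order all_algebra reals.

Set Implicit Arguments.
Unset Strict Implicit.
Unset Printing Implicit Defensive.

Record sgraph (T : finType) := SGraph {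
  adj :> rel T;
  adj_sym : symmetric adj;
  adj_irr : irreflexive adj
}.

Definition edges (T : finType) (G : sgraph T) : {set {set T}} :=
  [set [set p.1; p.2] | p in [set p : T * T | G p.1 p.2]].

Definition edge_type (T : finType) (G : sgraph T) : finType :=
  {e : {set T} | e \in edges G}.

Section Graphs.
Variables (T : finType) (G : sgraph T).

Definition line_adj : rel (edge_type G) :=
  fun e f => (e != f) && (val e :&: val f != set0).

Lemma line_adj_sym : symmetric line_adj.
Proof. by move=> e f; rewrite /line_adj eq_sym setIC. Qed.

Lemma line_adj_irr : irreflexive line_adj.
Proof. by move=> e; rewrite /line_adj eqxx. Qed.

Definition line_graph : sgraph (edge_type G) :=
  SGraph line_adj_sym line_adj_irr.

Definition compl_adj : rel T := fun x y => (x != y) && ~~ G x y.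

Lemma compl_adj_sym : symmetric compl_adj.
Proof. by move=> x y; rewrite /compl_adj eq_sym adj_sym. Qed.

Lemma compl_adj_irr : irreflexive compl_adj.
Proof. by move=> x; rewrite /compl_adj eqxx. Qed.

Definition compl_graph : sgraph T := SGraph compl_adj_sym compl_adj_irr.

End Graphs.

Section IntervalCompletion.
Variables (R : realType) (T : finType).
Local Open Scope ring_scope.

Definition interval_graph (K : sgraph T) : Prop :=
  exists l r : T -> R,
    (forall v, l v <= r v) /\
    (forall u v, u != v ->
       (K u v <-> exists x : R, x \in `[l u, r u] /\ x \in `[l v, r v])).

Definition interval_completion (H K : sgraph T) : Prop :=
  (forall x y, H x y -> K x y) /\ interval_graph K.

Definition min_interval_completion (H K : sgraph T) : Prop :=
  interval_completion H K /\
  (forall K', interval_completion H K' -> (#|edges K| <= #|edges K'|)%N).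

End IntervalCompletion.

(* Unit-cost random access machine.  The only arithmetic is addition and
   truncated subtraction, so that t steps produce numbers of O(t) more bits
   than the input and unit-cost polynomial time is Turing polynomial time.
   A program refers to finitely many registers; the memory is addressed
   indirectly, through registers. *)
Inductive instr :=
  | Const of nat & nat         (* Const r c   : reg r := c *)
  | Add of nat & nat & nat     (* Add r s t   : reg r := reg s + reg t *)
  | Sub of nat & nat & nat     (* Sub r s t   : reg r := reg s - reg t *)
  | Read of nat & nat          (* Read r s    : reg r := mem (reg s) *)
  | Write of nat & nat         (* Write r s   : mem (reg r) := reg s *)
  | Jump of nat                (* Jump l      : goto l *)
  | Jumpz of nat & nat.        (* Jumpz r l   : if reg r = 0 goto l *)

Definition program := seq instr.

Record config := Config { pc : nat; reg : nat -> nat; mem : nat -> nat }.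

Definition upd (f : nat -> nat) (a v : nat) : nat -> nat :=
  fun b => if b == a then v else f b.

Definition exec_instr (i : instr) (c : config) : config :=
  let: Config p g m := c in
  match i with
  | Const r k => Config p.+1 (upd g r k) m
  | Add r s t => Config p.+1 (upd g r (g s + g t)) m
  | Sub r s t => Config p.+1 (upd g r (g s - g t)) m
  | Read r s => Config p.+1 (upd g r (m (g s))) m
  | Write r s => Config p.+1 g (upd m (g r) (g s))
  | Jump l => Config l g m
  | Jumpz r l => Config (if g r == 0 then l else p.+1) g m
  end.

(* The machine halts when the program counter leaves the program. *)
Definition halted (P : program) (c : config) : bool := size P <= pc c.

Definition step (P : program) (c : config) : config :=
  if onth P (pc c) is Some i then exec_instr i c else c.

(* A graph on {0, ..., n-1} is given by n in register 0 and its n * n adjacency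
   matrix, row by row, from address 0; all other cells are 0. *)
Definition init (n : nat) (G : sgraph 'I_n) : config :=
  Config 0
    (fun r => if r == 0 then n else 0)
    (fun a => [exists i : 'I_n, exists j : 'I_n, (a == i * n + j) && G i j]).

(* A graph K on the edge set of G is returned as an n * n * n * n array stored
   right after the input: the entry of index (i, j, k, l) is the adjacency in K
   of the edges ij and kl of G.  Entries where ij or kl is not an edge are
   irrelevant. *)
Definition returns (n : nat) (G : sgraph 'I_n) (c : config)
    (K : sgraph (edge_type G)) : Prop :=
  forall (e f : edge_type G) (i j k l : 'I_n),
    val e = [set i; j] -> val f = [set k; l] ->
    mem c (n * n + (((i * n + j) * n + k) * n + l)) = K e f.

(* Main.v *)
(* The complement of an interval graph is the comparability graph of an interval
   order, so the task is to choose intervals on the edges of G such that disjoint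
   intervals belong to edges sharing an end, with as many disjoint pairs as
   possible.  Let ab be an edge whose interval ends first and ac one whose
   interval begins last (they share an end unless no two intervals are disjoint).
   Every edge having a successor meets ac and every edge having a predecessor
   meets ab.  If every comparable pair has a member at a, then ordering all edges
   at a in a chain loses nothing, up to at most two exceptional edges.  Otherwise
   comparable pairs cannot avoid the edges inside some {a, b, c, z}, and the
   remaining edges can be made uniform on each class.  So an optimum is described
   by boundedly many numbers of size O(n^2), and exhaustive search over them takes
   polynomial time.

   The search is an expression built from +, truncated subtraction, memory reads
   and bounded sums.  Such expressions compile to the random access machine with
   a running time polynomial in the input. *)

Require Import Defs.
From mathcomp Require Import all_boot all_order all_algebra reals.
From mathcomp Require Import zify.

Set Implicit Arguments.
Unset Strict Implicit.
Unset Printing Implicit Defensive.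

(** * Compilation of expressions *)

(** De Bruijn syntax: [Sum e1 e2] binds variable 0 of [e2], ranging below the value of [e1]. Sums
    are the only loops, so every expression terminates. *)
Inductive exp :=
  | Var of nat
  | Cst of nat
  | Plus of exp & exp
  | Minus of exp & exp
  | Deref of exp
  | Sum of exp & exp.

Definition scons (x : nat) (v : nat -> nat) : nat -> nat :=
  fun i => if i is j.+1 then v j else x.

Fixpoint eval (e : exp) (v m : nat -> nat) : nat :=
  match e with
  | Var i => v i
  | Cst c => c
  | Plus e1 e2 => eval e1 v m + eval e2 v m
  | Minus e1 e2 => eval e1 v m - eval e2 v m
  | Deref e1 => m (eval e1 v m)
  | Sum e1 e2 => \sum_(i < eval e1 v m) eval e2 (scons i v) m
  end.

(* The code of [e], placed at address [p], leaves the value of [e] in register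
   [d] and writes no register below [d]; [G] maps variables to registers. *)
Fixpoint compile (e : exp) (G : nat -> nat) (d p : nat) : seq instr :=
  match e with
  | Var i => [:: Const d 0; Add d d (G i)]
  | Cst c => [:: Const d c]
  | Plus e1 e2 =>
      let c1 := compile e1 G d p in
      let c2 := compile e2 G d.+1 (p + size c1) in
      c1 ++ c2 ++ [:: Add d d d.+1]
  | Minus e1 e2 =>
      let c1 := compile e1 G d p in
      let c2 := compile e2 G d.+1 (p + size c1) in
      c1 ++ c2 ++ [:: Defs.Sub d d d.+1]
  | Deref e1 => compile e1 G d p ++ [:: Read d d]
  | Sum e1 e2 =>
      let c1 := compile e1 G d p in
      let q := p + size c1 + 2 in
      let c2 := compile e2 (scons d.+2 G) d.+3 (q + 2) in
      c1 ++ [:: Const d.+1 0; Const d.+2 0;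
                Defs.Sub d.+3 d d.+2; Jumpz d.+3 (q + 2 + size c2 + 4)]
         ++ c2
         ++ [:: Add d.+1 d.+1 d.+3; Const d.+3 1; Add d.+2 d.+2 d.+3; Jump q;
                Const d 0; Add d d d.+1]
  end.

(** The exact number of steps of the compiled code. A loop takes 2 steps to initialise, 6 of
    overhead per round (2 for the test, 4 to accumulate, advance and jump) and 4 to leave. *)
Fixpoint cost (e : exp) (v m : nat -> nat) : nat :=
  match e with
  | Var _ => 2
  | Cst _ => 1
  | Plus e1 e2 | Minus e1 e2 => (cost e1 v m + cost e2 v m).+1
  | Deref e1 => (cost e1 v m).+1
  | Sum e1 e2 =>
      cost e1 v m + 2 + \sum_(i < eval e1 v m) (cost e2 (scons i v) m + 6) + 4
  end.

Definition code_at (P : program) (p : nat) (s : seq instr) :=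
  forall i, i < size s -> onth P (p + i) = onth s i.

Lemma code_at_cat P p s1 s2 :
  code_at P p (s1 ++ s2) -> code_at P p s1 /\ code_at P (p + size s1) s2.
Proof.
move=> H; split=> i Hi.
  by rewrite H ?size_cat; [rewrite onth_cat Hi | lia].
rewrite -addnA H ?size_cat ?ltn_add2l // onth_cat ltnNge leq_addr /=.
by rewrite addKn.
Qed.

Lemma code_at_cons P p i s :
  code_at P p (i :: s) -> onth P p = Some i /\ code_at P p.+1 s.
Proof.
move=> H; split; first by rewrite -(addn0 p) H.
by move=> j Hj; rewrite addSnnS H.
Qed.

Lemma run_cat P t1 t2 c1 c2 c3 :
  iter t1 (step P) c1 = c2 -> iter t2 (step P) c2 = c3 ->
  iter (t1 + t2) (step P) c1 = c3.
Proof. by move=> H1 H2; rewrite addnC iterD H1 H2. Qed.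

Lemma step_at P p g m i :
  onth P p = Some i -> step P (Config p g m) = exec_instr i (Config p g m).
Proof. by rewrite /step /= => ->. Qed.

Lemma upd_eq f a v : upd f a v a = v.
Proof. by rewrite /upd eqxx. Qed.

Lemma upd_neq f a v b : b != a -> upd f a v b = f b.
Proof. by rewrite /upd => /negbTE ->. Qed.

Ltac upds := repeat (rewrite upd_eq || (rewrite upd_neq; last by lia)).

Lemma compile_correct e : forall P G d p g m v,
  (forall i, G i < d) -> (forall i, g (G i) = v i) ->
  code_at P p (compile e G d p) ->
  exists g', [/\ iter (cost e v m) (step P) (Config p g m)
                   = Config (p + size (compile e G d p)) g' m,
                 g' d = eval e v m & forall r, r < d -> g' r = g r].
Proof.
elim: e => [i|c|e1 IH1 e2 IH2|e1 IH1 e2 IH2|e1 IH1|e1 IH1 e2 IH2] P G d p g m v HG Hg /=.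
- move=> /code_at_cons[H1 /code_at_cons[H2 _]].
  eexists; split; first by rewrite /= (step_at _ _ H1) /= (step_at _ _ H2) /= addn2.
  + by upds; rewrite upd_neq ?Hg //; have := HG i; lia.
  + by move=> r Hr; upds.
- move=> /code_at_cons[H1 _].
  eexists; split; first by rewrite /= (step_at _ _ H1) /= addn1.
  + by upds.
  + by move=> r Hr; upds.
- move=> /code_at_cat[H1 /code_at_cat[H2 /code_at_cons[H3 _]]].
  have [g1 [R1 V1 F1]] := IH1 _ _ _ _ g m v HG Hg H1.
  have HG' i : G i < d.+1 by apply: ltnW; rewrite ltnS.
  have Hg1 i : g1 (G i) = v i by rewrite F1.
  have [g2 [R2 V2 F2]] := IH2 _ _ _ _ g1 m v HG' Hg1 H2.
  have R12 := run_cat R1 R2.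
  eexists; split.
  + by rewrite R12 (step_at _ _ H3) /=; congr Config; rewrite !size_cat /=; lia.
  + by upds; rewrite V2 F2 // V1.
  + by move=> r Hr; upds; rewrite F2 ?F1 // ltnW.
- move=> /code_at_cat[H1 /code_at_cat[H2 /code_at_cons[H3 _]]].
  have [g1 [R1 V1 F1]] := IH1 _ _ _ _ g m v HG Hg H1.
  have HG' i : G i < d.+1 by apply: ltnW; rewrite ltnS.
  have Hg1 i : g1 (G i) = v i by rewrite F1.
  have [g2 [R2 V2 F2]] := IH2 _ _ _ _ g1 m v HG' Hg1 H2.
  have R12 := run_cat R1 R2.
  eexists; split.
  + by rewrite R12 (step_at _ _ H3) /=; congr Config; rewrite !size_cat /=; lia.
  + by upds; rewrite V2 F2 // V1.
  + by move=> r Hr; upds; rewrite F2 ?F1 // ltnW.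
- move=> /code_at_cat[H1 /code_at_cons[H2 _]].
  have [g1 [R1 V1 F1]] := IH1 _ _ _ _ g m v HG Hg H1.
  eexists; split.
  + by rewrite R1 (step_at _ _ H2) /=; congr Config; rewrite !size_cat /=; lia.
  + by upds; rewrite V1.
  + by move=> r Hr; upds; rewrite F1.
set c1 := compile e1 G d p; set q := p + size c1 + 2.
set c2 := compile e2 _ _ _; set N := eval e1 v m.
move=> /code_at_cat[H1 /code_at_cons[I1 /code_at_cons[I2 /code_at_cons[I3 /code_at_cons[I4]]]]].
move=> /code_at_cat[H2 /code_at_cons[J1 /code_at_cons[J2 /code_at_cons[J3 /code_at_cons[J4]]]]].
move=> /code_at_cons[J5 /code_at_cons[J6 _]].
have eq : (p + size c1).+2 = q by rewrite /q addn2.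
rewrite eq in I3 I4 H2 J1 J2 J3 J4 J5 J6.
have eq2 : q.+2 = q + 2 by rewrite addn2.
rewrite eq2 in H2 J1 J2 J3 J4 J5 J6.
have [g1 [R1 V1 F1]] := IH1 _ _ _ _ g m v HG Hg H1.
(* Invariant at the loop test [q]. The body writes only from [d.+3] on, so the bound, the partial
   sum and the index survive it. *)
have loop : forall k, k <= N -> exists g', [/\
   iter (cost e1 v m + 2 + \sum_(i < k) (cost e2 (scons i v) m + 6)) (step P) (Config p g m)
     = Config q g' m,
   [/\ g' d = N, g' d.+1 = \sum_(i < k) eval e2 (scons i v) m & g' d.+2 = k]
   & forall r, r < d -> g' r = g r].
  elim=> [_|k IHk Hk].
    eexists; split.
    + rewrite big_ord0 addn0; apply: run_cat R1 _ => /=.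
      by rewrite /= (step_at _ _ I1) /= (step_at _ _ I2) /= eq.
    + by rewrite big_ord0; split; upds.
    + by move=> r Hr; upds; rewrite F1.
  have [g2 [R2 [V2 W2 X2] F2]] := IHk (ltnW Hk).
  set g3 := upd g2 d.+3 (N - k).
  have HG3 i : scons d.+2 G i < d.+3.
    by case: i => [|i] //=; have := HG i; lia.
  have Hg3 i : g3 (scons d.+2 G i) = scons k v i.
    rewrite /g3; case: i => [|i] /=; first by upds.
    by rewrite upd_neq ?F2 ?Hg //; have := HG i; lia.
  have [g4 [R4 V4 F4]] := IH2 _ _ _ _ g3 m _ HG3 Hg3 H2.
  eexists; split.
  + rewrite big_ord_recr /= addnA; apply: run_cat R2 _.
    have -> : cost e2 (scons k v) m + 6 = 2 + (cost e2 (scons k v) m + 4) by lia.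
    apply: (@run_cat _ _ _ _ (Config (q + 2) g3 m)).
      rewrite /= (step_at _ _ I3) /= (step_at _ _ I4) /= upd_eq V2 X2 /g3.
      by rewrite (negbTE (_ : N - k != 0)) ?eq2 //; lia.
    apply: run_cat R4 _.
    by rewrite /= -/c2 (step_at _ _ J1) /= (step_at _ _ J2) /= (step_at _ _ J3) /=
      (step_at _ _ J4) /=.
  + rewrite big_ord_recr /=; split; upds.
    * by rewrite F4; [rewrite /g3; upds; rewrite V2|lia].
    * by rewrite V4 F4 // /g3; upds; rewrite W2.
    * by rewrite F4 // /g3; upds; rewrite X2 addn1.
  + by move=> r Hr; upds; rewrite F4 ?/g3; [upds; rewrite F2|lia].
have [g2 [R2 [V2 W2 X2] F2]] := loop N (leqnn N).
eexists; split.
+ apply: run_cat R2 _.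
  rewrite /= (step_at _ _ I3) /= (step_at _ _ I4) /= upd_eq V2 X2 subnn eqxx.
  rewrite [X in Config X](_ : _ = (q + 2 + size c2).+4); last by lia.
  rewrite (step_at _ _ J5) /= (step_at _ _ J6) /=.
  congr Config; rewrite size_cat /= size_cat /= -/c1 -/c2 /q; lia.
+ by upds; rewrite W2.
+ by move=> r Hr; upds; rewrite F2.
Qed.

(** The base [B + 2] is at least 2, so constant factors are absorbed by the exponent. Inside a sum
    the index may reach [(B + 2) ^ k1]; the induction hypothesis for the body is applied with this
    larger bound, which multiplies the exponents. *)
Lemma cost_poly e : exists k, forall v m B,
  (forall i, v i <= B) -> (forall a, m a <= B) ->
  eval e v m <= (B + 2) ^ k /\ cost e v m <= (B + 2) ^ k.
Proof.
have pos B k : 0 < (B + 2) ^ k by rewrite expn_gt0 addn2.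
have mono B k k' : k <= k' -> (B + 2) ^ k <= (B + 2) ^ k'.
  by move=> H; rewrite leq_pexp2l // addn2.
have ge2 B k : 2 * (B + 2) ^ k <= (B + 2) ^ k.+1.
  by rewrite expnS leq_mul2r; apply/orP; right; lia.
elim: e => [i|c|e1 [k1 IH1] e2 [k2 IH2]|e1 [k1 IH1] e2 [k2 IH2]|e1 [k1 IH1]|
  e1 [k1 IH1] e2 [k2 IH2]].
- by exists 1 => v m B Hv Hm /=; rewrite expn1; have := Hv i; lia.
- exists c => v m B Hv Hm /=; split=> //.
  case: c => // c; apply: (leq_trans (ltnW (ltn_expl c.+1 (ltnSn 1)))).
  by rewrite leq_exp2r // leq_addl.
- exists (maxn k1 k2).+2 => v m B Hv Hm /=.
  have [A1 C1] := IH1 v m B Hv Hm; have [A2 C2] := IH2 v m B Hv Hm.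
  have M1 := mono B _ _ (leq_maxl k1 k2); have M2 := mono B _ _ (leq_maxr k1 k2).
  have := ge2 B (maxn k1 k2); have := ge2 B (maxn k1 k2).+1.
  by have := pos B (maxn k1 k2); split; lia.
- exists (maxn k1 k2).+2 => v m B Hv Hm /=.
  have [A1 C1] := IH1 v m B Hv Hm; have [A2 C2] := IH2 v m B Hv Hm.
  have M1 := mono B _ _ (leq_maxl k1 k2); have M2 := mono B _ _ (leq_maxr k1 k2).
  have := ge2 B (maxn k1 k2); have := ge2 B (maxn k1 k2).+1.
  by have := pos B (maxn k1 k2); split; lia.
- exists k1.+1 => v m B Hv Hm /=.
  have [A1 C1] := IH1 v m B Hv Hm; have := ge2 B k1; have := pos B k1.
  by have := Hm (eval e1 v m); have := mono B 1 k1.+1 isT; rewrite expn1; split; lia.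
set K := k1.+2 * k2.
exists (k1 + K.+3).+2 => v m B Hv Hm /=.
have [A1 C1] := IH1 v m B Hv Hm.
have G1 := ge2 B k1; have G2 := ge2 B k1.+1; have P1 := pos B k1.
have M1 := mono B 1 k1.+1 isT; rewrite expn1 in M1.
have body i : i < eval e1 v m ->
    eval e2 (scons i v) m <= (B + 2) ^ K /\ cost e2 (scons i v) m <= (B + 2) ^ K.
  move=> Hi; have Hb : B + (B + 2) ^ k1 + 2 <= (B + 2) ^ k1.+2 by lia.
  have [||X Y] := IH2 (scons i v) m (B + (B + 2) ^ k1).
  - by case=> [|j] /=; [lia|have := Hv j; lia].
  - by move=> a; have := Hm a; lia.
  rewrite /K expnM; have Z : (B + (B + 2) ^ k1 + 2) ^ k2 <= ((B + 2) ^ k1.+2) ^ k2.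
    by case: (k2) => // k; rewrite leq_exp2r.
  by split; [apply: leq_trans X Z|apply: leq_trans Y Z].
have PK := pos B K.
have S1 : \sum_(i < eval e1 v m) eval e2 (scons i v) m <= (B + 2) ^ k1 * (B + 2) ^ K.
  apply: leq_trans (leq_mul A1 (leqnn _)).
  rewrite -[X in _ <= X * _](card_ord (eval e1 v m)) -sum_nat_const.
  by apply: leq_sum => i _; apply: (body i (ltn_ord i)).1.
have S2 : \sum_(i < eval e1 v m) (cost e2 (scons i v) m + 6) <= (B + 2) ^ k1 * (B + 2) ^ K.+3.
  apply: leq_trans (leq_mul A1 (leqnn _)).
  rewrite -[X in _ <= X * _](card_ord (eval e1 v m)) -sum_nat_const.
  apply: leq_sum => i _; have := (body i (ltn_ord i)).2.
  by have := ge2 B K; have := ge2 B K.+1; have := ge2 B K.+2; lia.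
rewrite -expnD in S1; rewrite -expnD in S2.
have M2 := mono B (k1 + K) (k1 + K.+3).+2 ltac:(lia).
have M3 := mono B k1 (k1 + K.+3) ltac:(lia).
have G3 := ge2 B (k1 + K.+3); have G4 := ge2 B (k1 + K.+3).+1.
have M4 := mono B 3 (k1 + K.+3) ltac:(lia).
have M5 : 8 <= (B + 2) ^ 3 by rewrite -[8]/(2 ^ 3) leq_exp2r // leq_addl.
(* Once the powers are generalised to variables, the goal is linear. *)
move: A1 C1 S1 S2 M2 M3 M4 M5 G3 G4; clear.
move: ((B + 2) ^ _) ((B + 2) ^ _) ((B + 2) ^ _) ((B + 2) ^ _) ((B + 2) ^ _) ((B + 2) ^ _).
by move: (cost _ _ _) (\sum_(_ < _) _) (\sum_(_ < _) _) => *; split; lia.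
Qed.

(** * A program that fills an array *)

Section Fill.
Variables (bound addr val : exp).

(* for i < bound do mem[addr(i)] := val(i); variable 0 of [addr] and [val] is
   the loop index, every other variable denotes register 0. *)
Let G0 : nat -> nat := fun=> 0.
Let c1 := compile bound G0 1 0.
Let q := size c1 + 1.
Let c2 := compile addr (scons 2 G0) 3 (q + 2).
Let c3 := compile val (scons 2 G0) 4 (q + 2 + size c2).

Definition fill_prog : program :=
  c1 ++ [:: Const 2 0; Defs.Sub 3 1 2; Jumpz 3 (q + 2 + size c2 + size c3 + 4)]
     ++ c2 ++ c3 ++ [:: Write 3 4; Const 3 1; Add 2 2 3; Jump q].

Fixpoint fill_mem (v m : nat -> nat) (i : nat) : nat -> nat :=
  if i is j.+1 then
    let m' := fill_mem v m j in
    upd m' (eval addr (scons j v) m') (eval val (scons j v) m')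
  else m.

Definition fill_cost (v m : nat -> nat) : nat :=
  cost bound v m + 1 +
  \sum_(i < eval bound v m)
     (cost addr (scons i v) (fill_mem v m i)
      + cost val (scons i v) (fill_mem v m i) + 6) + 2.

Lemma fill_correct g m (v := fun=> g 0) :
  exists g', iter (fill_cost v m) (step fill_prog) (Config 0 g m)
             = Config (size fill_prog) g' (fill_mem v m (eval bound v m)).
Proof.
set P := fill_prog; set N := eval bound v m.
have : code_at P 0 P by [].
rewrite {2}/P /fill_prog.
move=> /code_at_cat[H1 /code_at_cons[I1 /code_at_cons[I2 /code_at_cons[I3]]]].
move=> /code_at_cat[H2 /code_at_cat[H3]].
move=> /code_at_cons[J1 /code_at_cons[J2 /code_at_cons[J3 /code_at_cons[J4 _]]]].
rewrite !add0n in H1 I1 I2 I3 H2 H3 J1 J2 J3 J4.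
have eq1 : (size c1).+1 = q by rewrite /q addn1.
have eq2 : q.+2 = q + 2 by rewrite addn2.
rewrite !eq1 in I2 I3 H2 H3 J1 J2 J3 J4.
rewrite !eq2 in H2 H3 J1 J2 J3 J4.
have [g1 [R1 V1 F1]] :=
  @compile_correct bound P G0 1 0 g m v (fun=> isT) (fun=> erefl) H1.
rewrite add0n in R1.
have loop : forall k, k <= N -> exists g', [/\
   iter (cost bound v m + 1 +
      \sum_(i < k) (cost addr (scons i v) (fill_mem v m i)
                    + cost val (scons i v) (fill_mem v m i) + 6))
      (step P) (Config 0 g m) = Config q g' (fill_mem v m k),
   g' 0 = g 0, g' 1 = N & g' 2 = k].
  elim=> [_|k IHk Hk].
    eexists; split.
    + rewrite big_ord0 addn0; apply: run_cat R1 _.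
      by rewrite /= (step_at _ _ I1) /= eq1.
    + by upds; rewrite F1.
    + by upds; rewrite V1.
    + by upds.
  have [g2 [R2 A2 V2 X2]] := IHk (ltnW Hk).
  set mk := fill_mem v m k.
  set g3 := upd g2 3 (N - k).
  have Hg3 i : g3 (scons 2 G0 i) = scons k v i.
    by rewrite /g3; case: i => [|i] /=; upds.
  have [|g4 [R4 V4 F4]] := @compile_correct addr P (scons 2 G0) 3 (q + 2) g3 mk _ _ Hg3 H2.
    by case.
  have [||g5 [R5 V5 F5]] := @compile_correct val P (scons 2 G0) 4 _ g4 mk (scons k v) _ _ H3.
  - by case.
  - by case=> [|i] /=; rewrite F4 // -Hg3.
  eexists; split.
  + rewrite big_ord_recr /= addnA; apply: run_cat R2 _.
    rewrite -/mk.
    have -> : cost addr (scons k v) mk + cost val (scons k v) mk + 6 =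
              2 + (cost addr (scons k v) mk + (cost val (scons k v) mk + 4)) by lia.
    apply: (@run_cat _ _ _ _ (Config (q + 2) g3 mk)).
      rewrite /= (step_at _ _ I2) /= (step_at _ _ I3) /= upd_eq V2 X2 /g3.
      by rewrite (negbTE (_ : N - k != 0)) ?eq2 //; lia.
    apply: run_cat R4 _; apply: run_cat R5 _.
    rewrite /= (step_at _ _ J1) /= (step_at _ _ J2) /= (step_at _ _ J3) /=.
    by rewrite (step_at _ _ J4) /= V5 F5 // V4.
  + by upds; rewrite F5 // F4 // /g3; upds.
  + by upds; rewrite F5 // F4 // /g3; upds.
  + by upds; rewrite F5 // F4 // /g3; upds; rewrite X2 addn1.
have [g2 [R2 A2 V2 X2]] := loop N (leqnn N).
eexists; rewrite /fill_cost; apply: run_cat R2 _.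
rewrite /= (step_at _ _ I2) /= (step_at _ _ I3) /= upd_eq V2 X2 subnn eqxx.
congr Config; rewrite /P /fill_prog; do !rewrite size_cat /=.
by rewrite /q -/c1 -/c2 -/c3; lia.
Qed.

(** Each round reads a memory changed by the earlier rounds, so all intermediate memories must be
    bounded, not only the first. *)
Lemma fill_cost_poly : exists k, forall n m,
  (forall a, m a <= 1) ->
  (forall i, i <= eval bound (fun=> n) m -> forall a, fill_mem (fun=> n) m i a <= 1) ->
  fill_cost (fun=> n) m <= (n + 3) ^ k.
Proof.
have pos B k : 0 < (B + 2) ^ k by rewrite expn_gt0 addn2.
have mono B k k' : k <= k' -> (B + 2) ^ k <= (B + 2) ^ k'.
  by move=> H; rewrite leq_pexp2l // addn2.
have ge2 B k : 2 * (B + 2) ^ k <= (B + 2) ^ k.+1.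
  by rewrite expnS leq_mul2r; apply/orP; right; lia.
have [k1 IH1] := cost_poly bound; have [k2 IH2] := cost_poly addr.
have [k3 IH3] := cost_poly val.
set K := k1.+2 * maxn k2 k3.
(* [B = n + 1] bounds the variables and the 0/1 memory, and [n + 3] is [B + 2]. *)
exists (k1 + K.+4).+2 => n m Hm Hf; rewrite -[n + 3]/(n + (1 + 2)) addnA.
set B := n + 1; set v : nat -> nat := fun=> n.
have [||A1 C1] := IH1 v m B.
- by move=> i; rewrite /v /B leq_addr.
- by move=> a; apply: leq_trans (Hm a) _; rewrite leq_addl.
have G1 := ge2 B k1; have G2 := ge2 B k1.+1; have P1 := pos B k1.
have M1 := mono B 1 k1.+1 isT; rewrite expn1 in M1.
have Hb : B + (B + 2) ^ k1 + 2 <= (B + 2) ^ k1.+2 by lia.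
have Z k : k <= maxn k2 k3 -> (B + (B + 2) ^ k1 + 2) ^ k <= (B + 2) ^ K.
  move=> Hk; apply: leq_trans (_ : ((B + 2) ^ k1.+2) ^ k <= _).
    by case: (k) => // k'; rewrite leq_exp2r.
  by rewrite -expnM; apply: mono; rewrite /K leq_mul2l Hk orbT.
have body (i : 'I_(eval bound v m)) :
    cost addr (scons i v) (fill_mem v m i) + cost val (scons i v) (fill_mem v m i) + 6
    <= (B + 2) ^ K.+4.
  have Hv j : scons i v j <= B + (B + 2) ^ k1.
    by case: j => [|j] /=; [have := ltn_ord i; lia|rewrite /v /B; lia].
  have Hm' a : fill_mem v m i a <= B + (B + 2) ^ k1.
    by apply: leq_trans (Hf i _ a) _; [apply: ltnW|rewrite /B; lia].
  have [_ X] := IH2 _ _ _ Hv Hm'; have [_ Y] := IH3 _ _ _ Hv Hm'.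
  have := Z _ (leq_maxl k2 k3); have := Z _ (leq_maxr k2 k3); have := pos B K.
  have := ge2 B K; have := ge2 B K.+1; have := ge2 B K.+2; have := ge2 B K.+3.
  by lia.
have S : \sum_(i < eval bound v m)
     (cost addr (scons i v) (fill_mem v m i)
      + cost val (scons i v) (fill_mem v m i) + 6) <= (B + 2) ^ (k1 + K.+4).
  rewrite expnD; apply: leq_trans (leq_mul A1 (leqnn _)).
  rewrite -[X in _ <= X * _](card_ord (eval bound v m)) -sum_nat_const.
  by apply: leq_sum => i _; apply: body.
rewrite /fill_cost.
have M3 := mono B k1 (k1 + K.+4) ltac:(lia).
have G3 := ge2 B (k1 + K.+4); have G4 := ge2 B (k1 + K.+4).+1.
have M4 := mono B 3 (k1 + K.+4) ltac:(lia).
have M5 : 8 <= (B + 2) ^ 3 by rewrite -[8]/(2 ^ 3) leq_exp2r // leq_addl.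
move: C1 S M3 M4 M5 G3 G4; rewrite -/v; clear.
move: ((B + 2) ^ _) ((B + 2) ^ _) ((B + 2) ^ _) ((B + 2) ^ _) ((B + 2) ^ _).
by move: (cost _ _ _) (\sum_(_ < _) _) => *; lia.
Qed.

End Fill.

(** * Functions given by expressions *)

Definition upren (r : nat -> nat) : nat -> nat :=
  fun i => if i is j.+1 then (r j).+1 else 0.

Fixpoint rename (r : nat -> nat) (e : exp) : exp :=
  match e with
  | Var i => Var (r i)
  | Cst c => Cst c
  | Plus e1 e2 => Plus (rename r e1) (rename r e2)
  | Minus e1 e2 => Minus (rename r e1) (rename r e2)
  | Deref e1 => Deref (rename r e1)
  | Sum e1 e2 => Sum (rename r e1) (rename (upren r) e2)
  end.

Lemma eval_rename e : forall r v w m, (forall i, v (r i) = w i) ->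
  eval (rename r e) v m = eval e w m.
Proof.
elim: e => [i|c|e1 IH1 e2 IH2|e1 IH1 e2 IH2|e1 IH1|e1 IH1 e2 IH2] r v w m H //=;
  rewrite ?(IH1 _ _ _ _ H) ?(IH2 _ _ _ _ H) //.
by apply: eq_bigr => i _; apply: IH2; case=> [|j] /=.
Qed.

Definition computable (f : (nat -> nat) -> (nat -> nat) -> nat) :=
  exists e, forall v m, eval e v m = f v m.

(** A bounded sum of a function on [nat], with a head symbol that [comp_step] can match. *)
Definition nsum (N : nat) (F : nat -> nat) : nat := \sum_(i < N) F i.

Section Closure.
Implicit Types f g : (nat -> nat) -> (nat -> nat) -> nat.
Implicit Types b : (nat -> nat) -> (nat -> nat) -> bool.

Lemma computable_ext f g :
  computable f -> (forall v m, f v m = g v m) -> computable g.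
Proof. by case=> e He H; exists e => v m; rewrite He. Qed.

Lemma computable_var i : computable (fun v _ => v i).
Proof. by exists (Var i). Qed.

Lemma computable_cst c : computable (fun _ _ => c).
Proof. by exists (Cst c). Qed.

Lemma computable_ren r f : computable f -> computable (fun v m => f (fun i => v (r i)) m).
Proof. by case=> e He; exists (rename r e) => v m; rewrite -He; apply: eval_rename. Qed.

Lemma computable_add f g :
  computable f -> computable g -> computable (fun v m => f v m + g v m).
Proof. by case=> e He [e' He']; exists (Plus e e') => v m /=; rewrite He He'. Qed.

Lemma computable_sub f g :
  computable f -> computable g -> computable (fun v m => f v m - g v m).
Proof. by case=> e He [e' He']; exists (Minus e e') => v m /=; rewrite He He'. Qed.

Lemma computable_load f : computable f -> computable (fun v m => m (f v m)).
Proof. by case=> e He; exists (Deref e) => v m /=; rewrite He. Qed.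

Lemma computable_nsum f (F : (nat -> nat) -> (nat -> nat) -> nat -> nat) :
  computable f -> computable (fun v m => F (fun i => v i.+1) m (v 0)) ->
  computable (fun v m => nsum (f v m) (F v m)).
Proof.
case=> e He [e' He']; exists (Sum e e') => v m /=; rewrite He /nsum.
by apply: eq_bigr => i _; rewrite He'.
Qed.

Lemma computable_mul f g :
  computable f -> computable g -> computable (fun v m => f v m * g v m).
Proof.
move=> Hf Hg; apply: (@computable_ext (fun v m => nsum (f v m) (fun=> g v m))).
  exact: computable_nsum (computable_ren S Hg).
by move=> v m; rewrite /nsum sum_nat_const card_ord.
Qed.

Lemma computable_exp k f : computable f -> computable (fun v m => f v m ^ k).
Proof.
move=> Hf; elim: k => [|k IH]; first exact: computable_ext (computable_cst 1) _.
by apply: computable_ext (computable_mul Hf IH) _ => v m; rewrite expnS.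
Qed.

Lemma computable_leq f g :
  computable f -> computable g -> computable (fun v m => (f v m <= g v m) : nat).
Proof.
move=> Hf Hg.
apply: computable_ext (computable_sub (computable_cst 1) (computable_sub Hf Hg)) _.
by move=> v m; case: leqP; lia.
Qed.

Lemma computable_eq f g :
  computable f -> computable g -> computable (fun v m => (f v m == g v m) : nat).
Proof.
move=> Hf Hg.
apply: computable_ext (computable_mul (computable_leq Hf Hg) (computable_leq Hg Hf)) _.
by move=> v m; case: ltngtP.
Qed.

Lemma computable_negb b :
  computable (fun v m => b v m : nat) -> computable (fun v m => (~~ b v m) : nat).
Proof.
move=> H; apply: computable_ext (computable_sub (computable_cst 1) H) _.
by move=> v m; case: (b v m).
Qed.

Lemma computable_andb b b' :
  computable (fun v m => b v m : nat) -> computable (fun v m => b' v m : nat) ->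
  computable (fun v m => (b v m && b' v m) : nat).
Proof.
move=> H H'; apply: computable_ext (computable_mul H H') _.
by move=> v m; case: (b v m); case: (b' v m).
Qed.

Lemma computable_orb b b' :
  computable (fun v m => b v m : nat) -> computable (fun v m => b' v m : nat) ->
  computable (fun v m => (b v m || b' v m) : nat).
Proof.
move=> H H'.
apply: computable_ext
  (computable_negb (computable_andb (computable_negb H) (computable_negb H'))) _.
by move=> v m; case: (b v m); case: (b' v m).
Qed.

Lemma computable_if b f g :
  computable (fun v m => b v m : nat) -> computable f -> computable g ->
  computable (fun v m => if b v m then f v m else g v m).
Proof.
move=> H Hf Hg.
apply: computable_ext
  (computable_add (computable_mul H Hf) (computable_mul (computable_negb H) Hg)) _.
by move=> v m; case: (b v m); rewrite !(mul1n, mul0n) ?addn0.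
Qed.

(** Division and the search for a least maximiser are both counts of an initial segment. *)
Lemma nsum_ltn T x0 (F : nat -> bool) : x0 <= T ->
  (forall x, x < T -> F x = (x < x0)) -> nsum T F = x0.
Proof.
move=> H HF; rewrite /nsum -(big_mkord xpredT (fun i => F i : nat)).
rewrite (@big_cat_nat _ _ _ x0) //=.
rewrite [X in X + _](eq_big_nat _ _ (F2 := fun=> 1)); last first.
  by move=> i /andP[_ Hi]; rewrite HF ?Hi //; apply: leq_trans Hi H.
rewrite [X in _ + X](eq_big_nat _ _ (F2 := fun=> 0)); last first.
  by move=> i /andP[Hi Hi']; rewrite HF // ltnNge Hi.
by rewrite !sum_nat_const_nat muln1 muln0 addn0 subn0.
Qed.

(** The quotient counts the positive multiples of [y] up to [x]; the factor [0 < y] enforces the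
    convention that division by zero gives 0. *)
Lemma divn_nsum x y : (0 < y) * nsum x (fun i => i.+1 * y <= x) = x %/ y.
Proof.
case: y => [|y]; first by rewrite mul0n divn0.
by rewrite mul1n; apply: nsum_ltn => [|i _]; rewrite ?leq_div // -leq_divRL.
Qed.

Lemma computable_div f g :
  computable f -> computable g -> computable (fun v m => f v m %/ g v m).
Proof.
move=> Hf Hg; apply: computable_ext (fun v m => divn_nsum (f v m) (g v m)).
apply: computable_mul; first exact: computable_leq (computable_cst 1) Hg.
apply: (@computable_nsum f (fun v m i => i.+1 * g v m <= f v m)) => //.
apply: computable_leq (computable_ren S Hf).
apply: computable_mul (computable_ren S Hg).
by apply: computable_ext (computable_add (computable_var 0) (computable_cst 1)) _ => v m;
  rewrite addn1.
Qed.

Lemma computable_mod f g :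
  computable f -> computable g -> computable (fun v m => f v m %% g v m).
Proof.
move=> Hf Hg.
apply: computable_ext (computable_sub Hf (computable_mul (computable_div Hf Hg) Hg)) _.
by move=> v m; rewrite {1}(divn_eq (f v m) (g v m)) addKn.
Qed.

Lemma computable_succ f : computable f -> computable (fun v m => (f v m).+1).
Proof.
by move=> Hf; apply: computable_ext (computable_add Hf (computable_cst 1)) _ => v m; rewrite addn1.
Qed.

Lemma computable_big (s : seq nat) (F : nat -> (nat -> nat) -> (nat -> nat) -> nat) :
  (forall k, computable (F k)) -> computable (fun v m => \sum_(k <- s) F k v m).
Proof.
move=> H; elim: s => [|k s IH].
  by apply: computable_ext (computable_cst 0) _ => v m; rewrite big_nil.
by apply: computable_ext (computable_add (H k) IH) _ => v m; rewrite big_cons.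
Qed.

End Closure.

Ltac comp_step :=
  lazymatch goal with
  | |- computable (fun v m => nat_of_bool (leq (S _) _)) => apply: computable_leq;
    first apply: computable_succ
  | |- computable (fun v m => nat_of_bool (leq _ _)) => apply: computable_leq
  | |- computable (fun v m => nat_of_bool (_ == _)) => apply: computable_eq
  | |- computable (fun v m => nat_of_bool (_ && _)) => apply: computable_andb
  | |- computable (fun v m => nat_of_bool (_ || _)) => apply: computable_orb
  | |- computable (fun v m => nat_of_bool (~~ _)) => apply: computable_negb
  | |- computable (fun v m => if _ then _ else _) => apply: computable_if
  | |- computable (fun v m => addn _ _) => apply: computable_add
  | |- computable (fun v m => subn _ _) => apply: computable_sub
  | |- computable (fun v m => muln _ _) => apply: computable_mul
  | |- computable (fun v m => divn _ _) => apply: computable_div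
  | |- computable (fun v m => modn _ _) => apply: computable_mod
  | |- computable (fun v m => expn _ _) => apply: computable_exp
  | |- computable (fun v m => S _) => apply: computable_succ
  | |- computable (fun v m => m _) => apply: computable_load
  | |- computable (fun v m => nsum _ _) => apply: computable_nsum
  | |- computable (fun v m => v _) => apply: computable_var
  | |- _ => first [assumption | apply: computable_cst | apply: computable_ren; assumption]
  end.

Ltac comp := repeat comp_step.

(** * Candidate intervals *)

(* A parameter vector [p] encodes one of two kinds of intervals on the pairs of
   vertices.  If [p 0 = 0], with a, b, c, b', c' = p 1, ..., p 5, the edges at a
   form the chain ab < ab' < ... < ac' < ac, the other edges at b follow ab, the
   other edges at c precede ac, bb' also follows ab', and cc' also precedes ac'.
   Otherwise, with a, b, c, z = p 1, ..., p 4, the interval of an edge depends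
   only on which of a, b, c, z its ends are: left end p (6 + t) and length
   p (31 + t) for the class [t = cls2 i j]. *)
Section Candidate.
Variables (n : nat) (p : nat -> nat).

(** Point intervals for the edges at a: ab at 0, ab' at 1, ac' at [n + 3], ac at [n + 4], all others
    between 2 and [n + 1]. Thus bb' can begin at 2, after ab', and cc' can end at [n + 2], before
    ac'. *)
Definition ladder x :=
  if x == p 2 then 0 else if x == p 3 then n + 4
  else if x == p 4 then 1 else if x == p 5 then n + 3 else x + 2.

Definition lo_star i j :=
  if i == p 1 then ladder j else if j == p 1 then ladder i
  else if (i == p 2) || (j == p 2) then
    if (i == p 4) || (j == p 4) then 2 else 1
  else 0.

Definition hi_star i j :=
  if i == p 1 then ladder j else if j == p 1 then ladder i
  else if (i == p 3) || (j == p 3) then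
    if (i == p 5) || (j == p 5) then n + 2 else n + 3
  else n + 4.

Definition cls x :=
  if x == p 1 then 0 else if x == p 2 then 1 else if x == p 3 then 2
  else if x == p 4 then 3 else 4.

(** An unordered pair of classes, in base 5 with the smaller digit first. *)
Definition cls2 i j :=
  if cls i < cls j then 5 * cls i + cls j else 5 * cls j + cls i.

(** The lookup [p (o + k)] written as a sum over fixed positions, because [digit] is shown
    computable only at a constant position. *)
Definition table o k := \sum_(t <- iota 0 25) (t == k) * p (o + t).

Definition lo i j := if p 0 == 0 then lo_star i j else table 6 (cls2 i j).

Definition hi i j :=
  if p 0 == 0 then hi_star i j else table 6 (cls2 i j) + table 31 (cls2 i j).

End Candidate.

(** * The search over candidates *)

Definition disj (l r : nat -> nat -> nat) (i j k h : nat) : bool :=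
  (r i j < l k h) || (r k h < l i j).

Definition meet (i j k h : nat) : bool := (i == k) || (i == h) || (j == k) || (j == h).

Definition same (i j k h : nat) : bool := (i == k) && (j == h) || (i == h) && (j == k).

Definition sum4 (n : nat) (m : nat -> nat) (F : nat -> nat -> nat -> nat -> bool) : nat :=
  nsum n (fun i => nsum n (fun j => nsum n (fun k => nsum n (fun h =>
    m (i * n + j) * m (k * n + h) * F i j k h)))).

(** Parameters are vertices, a flag, and ends or lengths of at most [n * n]. *)
Definition base n := n * n + 2.

(** A parameter vector is packed into one number of 56 digits: 6 for the kind and the vertices, 25
    left ends and 25 lengths. *)
Definition digit (n c k : nat) : nat := c %/ base n ^ k %% base n.

Definition cdisj n c := disj (lo n (digit n c)) (hi n (digit n c)).

(** Invalid candidates get 0; the successor puts valid ones above them even when they have no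
    disjoint pair. *)
Definition score (n : nat) (m : nat -> nat) (c : nat) : nat :=
  if sum4 n m (fun i j k h => cdisj n c i j k h && ~~ meet i j k h) == 0 then
    (sum4 n m (cdisj n c)).+1
  else 0.

Definition is_best (n : nat) (m : nat -> nat) (c : nat) : bool :=
  nsum (base n ^ 56) (fun y => score n m c < score n m y) == 0.

(* Counts the [x] with no maximiser of [score] up to [x]: the least maximiser. *)
Definition best (n : nat) (m : nat -> nat) : nat :=
  nsum (base n ^ 56) (fun x => nsum x.+1 (fun y => is_best n m y) == 0).

Definition output (n : nat) (m : nat -> nat) (x : nat) : bool :=
  let h := x %% n in let k := x %/ n %% n in
  let j := x %/ n ^ 2 %% n in let i := x %/ n ^ 3 %% n in
  ~~ same i j k h && ~~ cdisj n (best n m) i j k h.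

(** * Computability of the search *)

Section CandidateComputable.
Implicit Types n c i j k h o : (nat -> nat) -> (nat -> nat) -> nat.

Lemma computable_digit t n c : computable n -> computable c ->
  computable (fun v m => digit (n v m) (c v m) t).
Proof. by move=> Hn Hc; rewrite /digit /base; comp. Qed.

Lemma computable_cls2 n c i j :
  computable n -> computable c -> computable i -> computable j ->
  computable (fun v m => cls2 (digit (n v m) (c v m)) (i v m) (j v m)).
Proof.
have H x : computable n -> computable c -> computable x ->
  computable (fun v m => cls (digit (n v m) (c v m)) (x v m)).
  by move=> Hn Hc Hx; rewrite /cls; repeat (apply: computable_digit || comp_step).
by move=> Hn Hc Hi Hj; rewrite /cls2; repeat (apply: H || comp_step).
Qed.

Lemma computable_table t n c k :
  computable n -> computable c -> computable k ->
  computable (fun v m => table (digit (n v m) (c v m)) t (k v m)).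
Proof.
move=> Hn Hc Hk; rewrite /table; apply: computable_big => s.
by repeat (apply: computable_digit || comp_step).
Qed.

Lemma computable_ladder n c x : computable n -> computable c -> computable x ->
  computable (fun v m => ladder (n v m) (digit (n v m) (c v m)) (x v m)).
Proof.
by move=> Hn Hc Hx; rewrite /ladder; repeat (apply: computable_digit || comp_step).
Qed.

Lemma computable_lo_star n c i j :
  computable n -> computable c -> computable i -> computable j ->
  computable (fun v m => lo_star (n v m) (digit (n v m) (c v m)) (i v m) (j v m)).
Proof.
move=> Hn Hc Hi Hj; rewrite /lo_star.
by repeat (apply: computable_ladder || apply: computable_digit || comp_step).
Qed.

Lemma computable_hi_star n c i j :
  computable n -> computable c -> computable i -> computable j ->
  computable (fun v m => hi_star (n v m) (digit (n v m) (c v m)) (i v m) (j v m)).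
Proof.
move=> Hn Hc Hi Hj; rewrite /hi_star.
by repeat (apply: computable_ladder || apply: computable_digit || comp_step).
Qed.

Lemma computable_lo n c i j :
  computable n -> computable c -> computable i -> computable j ->
  computable (fun v m => lo (n v m) (digit (n v m) (c v m)) (i v m) (j v m)).
Proof.
move=> Hn Hc Hi Hj; rewrite /lo.
by repeat (apply: computable_lo_star || apply: computable_table
  || apply: computable_cls2 || apply: computable_digit || comp_step).
Qed.

Lemma computable_hi n c i j :
  computable n -> computable c -> computable i -> computable j ->
  computable (fun v m => hi (n v m) (digit (n v m) (c v m)) (i v m) (j v m)).
Proof.
move=> Hn Hc Hi Hj; rewrite /hi.
by repeat (apply: computable_hi_star || apply: computable_table
  || apply: computable_cls2 || apply: computable_digit || comp_step).
Qed.

Lemma computable_cdisj n c i j k h :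
  computable n -> computable c -> computable i -> computable j ->
  computable k -> computable h ->
  computable (fun v m => cdisj (n v m) (c v m) (i v m) (j v m) (k v m) (h v m)).
Proof.
move=> Hn Hc Hi Hj Hk Hh; rewrite /cdisj /disj.
by repeat (apply: computable_lo || apply: computable_hi || comp_step).
Qed.

Lemma computable_score n c : computable n -> computable c ->
  computable (fun v m => score (n v m) m (c v m)).
Proof.
move=> Hn Hc; rewrite /score /sum4 /meet.
by repeat (apply: computable_cdisj || comp_step).
Qed.

Lemma computable_best n : computable n -> computable (fun v m => best (n v m) m).
Proof.
move=> Hn; rewrite /best /is_best /base.
by repeat (apply: computable_score || comp_step).
Qed.

Lemma computable_output n x : computable n -> computable x ->
  computable (fun v m => output (n v m) m (x v m)).
Proof.
move=> Hn Hx; rewrite /output /same.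
by repeat (apply: computable_cdisj || apply: computable_best || comp_step).
Qed.

End CandidateComputable.

(** * Symmetry and validity of candidate intervals; a double count *)

Lemma lo_sym n p i j : lo n p i j = lo n p j i.
Proof.
rewrite /lo; case: ifP => _; last first.
  by congr table; rewrite /cls2; case: ltngtP => // ->.
rewrite /lo_star [(i == p 2) || _]orbC [(i == p 4) || _]orbC.
by do 2 case: eqP => // ?; congr ladder; lia.
Qed.

Lemma hi_sym n p i j : hi n p i j = hi n p j i.
Proof.
rewrite /hi; case: ifP => _; last first.
  by congr (_ + _); congr table; rewrite /cls2; case: ltngtP => // ->.
rewrite /hi_star [(i == p 3) || _]orbC [(i == p 5) || _]orbC.
by do 2 case: eqP => // ?; congr ladder; lia.
Qed.

Lemma lo_le_hi n p i j : lo n p i j <= hi n p i j.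
Proof.
rewrite /lo /hi; case: ifP => _; last exact: leq_addr.
by rewrite /lo_star /hi_star; do 2 (case: ifP => // _); repeat case: ifP => _; lia.
Qed.

(** Intervals of edges off a begin by 2 and end no earlier than [n + 2], so any two of them overlap.
    Such an edge is separated from an edge at a only at the two lowest or two highest rungs, where
    they share b, b', c or c'. *)
Lemma star_meet n p i j k h : i < n -> j < n -> k < n -> h < n ->
  hi_star n p i j < lo_star n p k h -> meet i j k h.
Proof.
move=> Hi Hj Hk Hh; rewrite /hi_star /lo_star /ladder /meet.
by repeat (case: ifP => ?); lia.
Qed.

Lemma sum_delta N k (f : nat -> nat) : k < N ->
  \sum_(t <- iota 0 N) (t == k) * f t = f k.
Proof.
move=> Hk; rewrite (bigD1_seq k) ?mem_iota ?iota_uniq //= eqxx mul1n big1 ?addn0 //.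
by move=> i /negbTE ->.
Qed.

(** The double sum splits into pairs inside [K], mixed pairs, counted twice by symmetry, and pairs
    outside [K], of which [f] has none. This is the count behind symmetrisation. *)
Lemma sum_pairs_le (D : finType) (P K : pred D) (f g : rel D) :
  symmetric f -> symmetric g ->
  (forall d d', P d -> P d' -> K d -> K d' -> f d d' -> g d d') ->
  (forall d, P d -> ~~ K d ->
     \sum_(d' | P d' && K d') f d d' <= \sum_(d' | P d' && K d') g d d') ->
  (forall d d', P d -> P d' -> ~~ K d -> ~~ K d' -> ~~ f d d') ->
  \sum_(d | P d) \sum_(d' | P d') f d d' <= \sum_(d | P d) \sum_(d' | P d') g d d'.
Proof.
move=> fS gS HKK Hdeg Hout.
have split2 (r : rel D) : symmetric r ->
  \sum_(d | P d) \sum_(d' | P d') r d d' =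
  \sum_(d | P d && K d) \sum_(d' | P d' && K d') r d d' +
  \sum_(d | P d && ~~ K d) \sum_(d' | P d' && K d') r d d' * 2 +
  \sum_(d | P d && ~~ K d) \sum_(d' | P d' && ~~ K d') r d d'.
  move=> rS; rewrite (bigID K) /=.
  under eq_bigr do rewrite (bigID K) /=.
  under [X in _ + X]eq_bigr do rewrite (bigID K) /=.
  rewrite !big_split /= [X in _ + X + _]exchange_big /=.
  under [X in _ + X + _]eq_bigr do under eq_bigr do rewrite rS.
  under [X in _ = _ + X + _]eq_bigr do rewrite -big_distrl /=.
  rewrite -big_distrl /= muln2 -addnn; lia.
rewrite (split2 f fS) (split2 g gS); apply: leq_add; first apply: leq_add.
- apply: leq_sum => d /andP[Pd Kd]; apply: leq_sum => d' /andP[Pd' Kd'].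
  by case: (f d d') (HKK d d' Pd Pd' Kd Kd') => // ->.
- apply: leq_sum => d /andP[Pd Kd].
  by rewrite -!big_distrl leq_mul2r /= Hdeg.
- rewrite big1 // => d /andP[Pd Kd]; rewrite big1 // => d' /andP[Pd' Kd'].
  by rewrite (negbTE (Hout _ _ Pd Pd' Kd Kd')).
Qed.

(** Contraposed: edges without a common end get intersecting intervals, so the overlap graph
    completes the complement of the line graph. *)
Definition valid (E : rel nat) (l r : nat -> nat -> nat) :=
  forall i j k h, E i j -> E k h -> disj l r i j k h -> meet i j k h.

(** Edges appear as ordered pairs of vertices, so for the adjacency of a graph each ordered pair of
    edges counts four times. *)
Definition disj_count (n : nat) (E : rel nat) (l r : nat -> nat -> nat) : nat :=
  \sum_(d : 'I_n * 'I_n | E d.1 d.2) \sum_(d' : 'I_n * 'I_n | E d'.1 d'.2)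
    disj l r d.1 d.2 d'.1 d'.2.

(** * Symmetrisation *)

Definition dominated (n : nat) (E : rel nat) (l r : nat -> nat -> nat) : Prop :=
  exists p, [/\ forall k, p k < base n, valid E (lo n p) (hi n p)
    & disj_count n E l r <= disj_count n E (lo n p) (hi n p)].

Lemma cls_le p x : cls p x <= 4.
Proof. by rewrite /cls; repeat case: ifP => _. Qed.

Lemma cls_inj p x y : cls p x < 4 -> cls p x = cls p y -> x = y.
Proof. by rewrite /cls; repeat (case: eqP => [?|?] //=); congruence. Qed.

Lemma cls2_lt p i j : cls2 p i j < 25.
Proof.
by rewrite /cls2; have := cls_le p i; have := cls_le p j; case: ifP => _; lia.
Qed.

Lemma cls2_eq p i j k h : cls2 p i j = cls2 p k h ->
  cls p i = cls p k /\ cls p j = cls p h \/ cls p i = cls p h /\ cls p j = cls p k.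
Proof.
rewrite /cls2; have := cls_le p i; have := cls_le p j; have := cls_le p k; have := cls_le p h.
move: (cls p i) (cls p j) (cls p k) (cls p h) => x y z w.
by case: ifP => ?; case: ifP => ?; lia.
Qed.

(* If no two disjoint intervals both belong to edges leaving {a, b, c, z}, each
   such edge may be given the interval of the edge of its class which is disjoint
   from most intervals of edges inside {a, b, c, z}. *)
Section Table.
Variables (n : nat) (E : rel nat).
Hypotheses (Esym : symmetric E) (Eltn : forall i j, E i j -> i < n).
Variables (l r : nat -> nat -> nat).
Hypotheses (lsym : forall i j, l i j = l j i) (rsym : forall i j, r i j = r j i).
Hypothesis ler : forall i j, E i j -> l i j <= r i j.
Hypothesis V : valid E l r.
Hypotheses (lmax : forall i j, l i j <= n * n) (rmax : forall i j, r i j <= n * n).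
Variables (a b c z : nat).
Hypotheses (Ha : a < n) (Hb : b < n) (Hc : c < n) (Hz : z < n).

Let q := nth 0 [:: 1; a; b; c; z].
Let D : finType := ('I_n * 'I_n)%type.
Let P (d : D) := E d.1 d.2.
Let K (d : D) := (cls q d.1 < 4) && (cls q d.2 < 4).
Let f (d d' : D) := disj l r d.1 d.2 d'.1 d'.2.
Let ix (d : D) := cls2 q d.1 d.2.
Let deg (d : D) := \sum_(d' | P d' && K d') f d d'.

Hypothesis noout : forall i j k h, E i j -> E k h -> r i j < l k h ->
  (cls q i < 4) && (cls q j < 4) || (cls q k < 4) && (cls q h < 4).

Let rep_pred k (d : D) :=
  [&& P d, ix d == k & [forall d' : D, (P d' && (ix d' == k)) ==> (deg d' <= deg d)]].
Let rep k : option D := [pick d | rep_pred k d].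

Let repP (d : D) : P d -> exists d0 : D, [/\ rep (ix d) = Some d0, P d0,
  ix d0 = ix d & deg d <= deg d0].
Proof.
move=> Pd; rewrite /rep; case: pickP => [d0 /and3P[P0 /eqP i0 /forallP H]|H].
  by exists d0; split=> //; apply: (implyP (H d)); rewrite Pd eqxx.
have Q : [pred d' | P d' && (ix d' == ix d)] d by rewrite /= Pd eqxx.
have := H [arg max_(d' > d | P d' && (ix d' == ix d)) deg d'].
case: arg_maxnP => //= d0 /andP[P0 i0] H0; rewrite /rep_pred P0 i0 /=.
by move/forallP; case=> d'; apply/implyP => Hd'; apply: H0.
Qed.

Let lw k := if rep k is Some d then l d.1 d.2 else 0.
Let ww k := if rep k is Some d then r d.1 d.2 - l d.1 d.2 else 0.
Let p := nth 0 ([:: 1; a; b; c; z; 0] ++ map lw (iota 0 25) ++ map ww (iota 0 25)).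

Let pcls2 i j : cls2 p i j = cls2 q i j.
Proof. by []. Qed.

Let plw t : t < 25 -> p (6 + t) = lw t.
Proof.
move=> Ht; change (p (6 + t)) with (nth 0 (map lw (iota 0 25) ++ map ww (iota 0 25)) t).
by rewrite nth_cat size_map size_iota Ht (nth_map 0) ?size_iota // nth_iota.
Qed.

Let pww t : t < 25 -> p (31 + t) = ww t.
Proof.
move=> Ht; change (p (31 + t)) with (nth 0 (map ww (iota 0 25)) t).
by rewrite (nth_map 0) ?size_iota // nth_iota.
Qed.

Let plo i j : lo n p i j = lw (cls2 q i j).
Proof.
rewrite /lo -[RHS](sum_delta _ (cls2_lt q i j)) /= /table; apply: eq_big_seq => t.
by rewrite mem_iota => Ht; rewrite plw // pcls2.
Qed.

Let phi i j : hi n p i j = lw (cls2 q i j) + ww (cls2 q i j).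
Proof.
rewrite -plo /hi /lo /=; congr (_ + _).
rewrite -[RHS](sum_delta _ (cls2_lt q i j)) /= /table; apply: eq_big_seq => t.
by rewrite mem_iota => Ht; rewrite pww // pcls2.
Qed.

(** Since [cls] is injective below 4, an edge inside {a, b, c, z} is alone in its class up to
    orientation, and so keeps its interval. *)
Let repK (d d0 : D) : ix d0 = ix d -> K d ->
  K d0 /\ l d0.1 d0.2 = l d.1 d.2 /\ r d0.1 d0.2 = r d.1 d.2.
Proof.
rewrite /ix /K => /cls2_eq H /andP[K1 K2].
case: H => -[e1 e2]; rewrite e1 e2 K1 K2.
  have -> := cls_inj K1 (esym e1); have -> := cls_inj K2 (esym e2).
  by split.
have -> := cls_inj K1 (esym e2); have -> := cls_inj K2 (esym e1).
by split.
Qed.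

Let prep (d : D) : P d -> exists d0 : D, [/\ P d0, ix d0 = ix d, deg d <= deg d0,
  lo n p d.1 d.2 = l d0.1 d0.2 & hi n p d.1 d.2 = r d0.1 d0.2].
Proof.
move=> Pd; have [d0 [R P0 i0 dg]] := repP Pd; exists d0; split=> //.
  by rewrite plo /lw -/(ix d) R.
by rewrite phi /lw /ww -/(ix d) R subnKC //; apply: ler.
Qed.

Let f_K (d d' : D) : P d -> P d' -> f d d' -> K d || K d'.
Proof.
move=> Pd Pd' /orP[] H; first exact: noout H.
by rewrite orbC; apply: noout H.
Qed.

(** A vertex shared with an edge inside {a, b, c, z} is one of these four, and its class determines
    it. *)
Let meet_rep (d d0 d' : D) : ix d0 = ix d -> K d' ->
  meet d0.1 d0.2 d'.1 d'.2 -> meet d.1 d.2 d'.1 d'.2.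
Proof.
move=> /cls2_eq H /andP[K1 K2] M.
have inj1 x : cls q d'.1 = cls q x -> (x == d'.1) by move=> e; rewrite (cls_inj K1 e).
have inj2 x : cls q d'.2 = cls q x -> (x == d'.2) by move=> e; rewrite (cls_inj K2 e).
have pick x : (x == d'.1 :> nat) || (x == d'.2 :> nat) ->
    cls q d.1 = cls q x \/ cls q d.2 = cls q x -> meet d.1 d.2 d'.1 d'.2.
  rewrite /meet; case/orP=> /eqP -> [] e.
  - by rewrite inj1.
  - by rewrite [d.2 == d'.1 :> nat]inj1 ?orbT.
  - by rewrite [d.1 == d'.2 :> nat]inj2 ?orbT.
  - by rewrite [d.2 == d'.2 :> nat]inj2 ?orbT.
move: M; rewrite {1}/meet -orbA; case/orP=> [/pick|/pick] M; apply: M.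
  by case: H => -[-> _]; [left|right].
by case: H => -[_ ->]; [right|left].
Qed.

(** Every disjoint pair touches [K], whose edges keep their intervals. Other edges take the interval
    of a representative whose degree into [K] is no smaller: [meet_rep] carries validity over and
    [sum_pairs_le] gives the count. *)
Lemma table_case : dominated n E l r.
Proof.
exists p; split.
- move=> k; rewrite /base.
  set s := [:: 1; a; b; c; z; 0] ++ map lw (iota 0 25) ++ map ww (iota 0 25).
  have A : all (fun x => x < n * n + 2) s.
    rewrite !all_cat !all_map; apply/and3P; split.
    + have B x : x < n -> x < n * n + 2 by nia.
      by rewrite /= (B a Ha) (B b Hb) (B c Hc) (B z Hz) /=; clear; lia.
    + apply/allP => t _ /=; rewrite /lw addn2 ltnS.
      by case: (rep t) => // d; apply: leq_trans (lmax _ _) _.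
    + apply/allP => t _ /=; rewrite /ww addn2 ltnS.
      case: (rep t) => // d; apply: leq_trans (leq_subr _ _) _.
      by apply: leq_trans (rmax _ _) _.
  rewrite /p -/s; case: (ltnP k (size s)) => Hk; first exact: (all_nthP 0 A).
  by rewrite nth_default // addn2.
- move=> i j k h Ei Ek H.
  have Ei' : E j i by rewrite Esym.
  have Ek' : E h k by rewrite Esym.
  pose d : D := (Ordinal (Eltn Ei), Ordinal (Eltn Ei')).
  pose d' : D := (Ordinal (Eltn Ek), Ordinal (Eltn Ek')).
  have [d0 [P0 i0 _ l0 r0]] := @prep d Ei; have [d1 [P1 i1 _ l1 r1]] := @prep d' Ek.
  have H' : f d0 d1 by move: H; rewrite /f /disj -l0 -l1 -r0 -r1.
  case/orP: (f_K P0 P1 H') => KK.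
    have [Kd [ld rd]] := repK (esym i0) KK.
    have M : meet d1.1 d1.2 d.1 d.2.
      by apply: (V P1 (Ei : E d.1 d.2)); rewrite /disj ld rd; move: H'; rewrite /f /disj orbC.
    by have := meet_rep i1 Kd M; rewrite /meet /=; clear; lia.
  have [Kd [ld rd]] := repK (esym i1) KK.
  have M : meet d0.1 d0.2 d'.1 d'.2.
    by apply: (V P0 (Ek : E d'.1 d'.2)); rewrite /disj ld rd.
  exact: meet_rep i0 Kd M.
- pose g (d d' : D) := disj (lo n p) (hi n p) d.1 d.2 d'.1 d'.2.
  have gK (d d' : D) : P d' -> K d' -> forall d0 : D, 
    lo n p d.1 d.2 = l d0.1 d0.2 -> hi n p d.1 d.2 = r d0.1 d0.2 -> g d d' = f d0 d'.
    move=> Pd' Kd' d0 l0 r0; have [d1 [P1 i1 _ l1 r1]] := prep Pd'.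
    have [_ [ld rd]] := repK i1 Kd'.
    by rewrite /g /f /disj l0 r0 l1 r1 ld rd.
  apply: (@sum_pairs_le D P K f g).
  + by move=> d d'; rewrite /f /disj orbC.
  + by move=> d d'; rewrite /g /disj orbC.
  + move=> d d' Pd Pd' Kd Kd'.
    have [d1 [P1 i1 _ l1 r1]] := prep Pd; have [_ [ld rd]] := repK i1 Kd.
    by rewrite (gK d d' Pd' Kd' d) // ?l1 ?r1 ?ld ?rd.
  + move=> d Pd _; have [d0 [P0 i0 dg l0 r0]] := prep Pd.
    apply: leq_trans dg _; apply: leq_sum => d' /andP[Pd' Kd'].
    by rewrite (gK d d' Pd' Kd' d0).
  + move=> d d' Pd Pd' Kd Kd'; apply/negP => /(f_K Pd Pd').
    by rewrite (negbTE Kd) (negbTE Kd').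
Qed.

End Table.

Lemma ladder_inj n p x y : x < n -> y < n -> ladder n p x = ladder n p y -> x = y.
Proof. by move=> Hx Hy; rewrite /ladder; repeat (case: ifP => ?); lia. Qed.

Section StarDisjoint.
Variables (n : nat) (p : nat -> nat).
Hypothesis p21 : p 2 != p 1.
Hypothesis p31 : p 3 != p 1.
Hypothesis p32 : p 3 != p 2.

Lemma star_first x : x != p 1 -> hi_star n p (p 1) (p 2) < lo_star n p (p 2) x.
Proof.
move=> /negbTE nx; rewrite /hi_star /lo_star /ladder !eqxx (negbTE p21) nx /=.
by case: ifP.
Qed.

Lemma star_second : p 4 != p 1 -> p 4 != p 2 -> p 4 != p 3 ->
  hi_star n p (p 1) (p 4) < lo_star n p (p 2) (p 4).
Proof.
move=> /negbTE n1 /negbTE n2 /negbTE n3.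
by rewrite /hi_star /lo_star /ladder !eqxx (negbTE p21) n1 n2 n3 /= orbT.
Qed.

Lemma star_last x : x != p 1 -> hi_star n p (p 3) x < lo_star n p (p 1) (p 3).
Proof.
move=> /negbTE nx; rewrite /hi_star /lo_star /ladder !eqxx (negbTE p31) nx (negbTE p32) /=.
by case: ifP; rewrite ltn_add2l.
Qed.

Lemma star_before_last : p 5 != p 1 -> p 5 != p 2 -> p 5 != p 3 -> p 5 != p 4 ->
  hi_star n p (p 3) (p 5) < lo_star n p (p 1) (p 5).
Proof.
move=> /negbTE n1 /negbTE n2 /negbTE n3 /negbTE n4.
by rewrite /hi_star /lo_star /ladder !eqxx (negbTE p31) n1 n2 n3 n4 /= orbT ltn_add2l.
Qed.

End StarDisjoint.

(** * Domination by candidates *)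

Lemma meetF x y w z : x != w -> x != z -> y != w -> y != z -> meet x y w z -> False.
Proof. by rewrite /meet => /negbTE-> /negbTE-> /negbTE-> /negbTE->. Qed.

Lemma meet_eq x y w z : x != w -> x != z -> y != w -> meet x y w z -> y = z.
Proof. by rewrite /meet => /negbTE-> /negbTE-> /negbTE-> /eqP. Qed.

Ltac neq := first [assumption | by rewrite eq_sym].

Section Combinatorics.
Variables (n : nat) (E : rel nat).
Hypotheses (Esym : symmetric E) (Eirr : irreflexive E).
Hypothesis Eltn : forall i j, E i j -> i < n.

Let Eltn2 i j : E i j -> j < n.
Proof. by rewrite Esym => /Eltn. Qed.

Let Eneq i j : E i j -> i <> j.
Proof. by move=> H e; rewrite e Eirr in H. Qed.

Ltac neqE := apply/eqP; first [apply: Eneq; assumption | apply: not_eq_sym; apply: Eneq;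
  assumption].

Lemma star_valid p : p 0 = 0 -> valid E (lo n p) (hi n p).
Proof.
move=> p0 i j k h Eij Ekh; rewrite /disj /lo /hi p0 eqxx.
have [] := (Eltn Eij, Eltn2 Eij, Eltn Ekh, Eltn2 Ekh) => [[[Hi Hj] Hk] Hh].
by case/orP=> H; [exact: star_meet H|have := star_meet Hk Hh Hi Hj H; rewrite /meet; lia].
Qed.

Section Given.
Variables (l r : nat -> nat -> nat).
Hypotheses (lsym : forall i j, l i j = l j i) (rsym : forall i j, r i j = r j i).
Hypothesis ler : forall i j, E i j -> l i j <= r i j.
Hypothesis V : valid E l r.

Let V1 i j k h : E i j -> E k h -> r i j < l k h -> meet i j k h.
Proof. by move=> Ei Ek H; apply: V => //; rewrite /disj H. Qed.

Variables (a b c : nat).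
Hypotheses (Eab : E a b) (Eac : E a c) (ab_ac : r a b < l a c).
Hypothesis rmin : forall i j, E i j -> r a b <= r i j.
Hypothesis lmax : forall i j, E i j -> l i j <= l a c.

Let nbc : b <> c.
Proof. by move=> e; have := ler Eab; move: ab_ac; rewrite e; lia. Qed.

(* As [i j] precedes [a c] and [k h] follows [a b], both meet the path [b a c]. *)
Let left_form i j k h : E i j -> E k h -> r i j < l k h ->
  exists x y, [/\ E x y, l i j = l x y, r i j = r x y, same i j x y
    & x = a /\ y <> c \/ x = c /\ y <> a].
Proof.
move=> Ei Ek H; have H' : r i j < l a c by apply: leq_trans H (lmax Ek).
have M := V1 Ei Eac H'; have L := ler Eac.
(* An edge with a successor is not ac itself, which cannot end before it begins. *)
have N x y : E x y -> r x y < l a c -> same x y a c -> False.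
  move=> Ex Hx; rewrite /same.
  case/orP=> /andP[/eqP ex /eqP ey]; subst; move: Hx L; rewrite ?(rsym c a); lia.
have NN := N _ _ Ei H'.
have : (i == a) || (i == c) || (j == a) || (j == c) by move: M; rewrite /meet; lia.
rewrite /same in NN *.
case/orP; [case/orP; [case/orP|]|] => /eqP e; subst.
- exists a, j; split=> //; [by rewrite !eqxx|by left; split=> // e; apply: NN; rewrite e !eqxx].
- exists c, j; split=> //; [by rewrite !eqxx|by right; split=> // e; apply: NN;
  rewrite e !eqxx orbT].
- exists a, i; split; rewrite 1?Esym //; first by rewrite !eqxx orbT.
  by left; split=> // e; apply: NN; rewrite e !eqxx orbT.
- exists c, i; split; rewrite 1?Esym //; first by rewrite !eqxx orbT.
  by right; split=> // e; apply: NN; rewrite e !eqxx.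
Qed.

Let right_form i j k h : E i j -> E k h -> r i j < l k h ->
  exists x y, [/\ E x y, l k h = l x y, r k h = r x y, same k h x y
    & x = a /\ y <> b \/ x = b /\ y <> a].
Proof.
move=> Ei Ek H; have H' : r a b < l k h by apply: leq_ltn_trans (rmin Ei) H.
have M := V1 Eab Ek H'; have L := ler Eab.
have N x y : E x y -> r a b < l x y -> same x y a b -> False.
  move=> Ex Hx; rewrite /same.
  case/orP=> /andP[/eqP ex /eqP ey]; subst; move: Hx L; rewrite ?(lsym b a); lia.
have NN := N _ _ Ek H'.
have : (k == a) || (k == b) || (h == a) || (h == b) by move: M; rewrite /meet; lia.
rewrite /same in NN *.
case/orP; [case/orP; [case/orP|]|] => /eqP e; subst.
- exists a, h; split=> //; [by rewrite !eqxx|by left; split=> // e; apply: NN; rewrite e !eqxx].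
- exists b, h; split=> //; [by rewrite !eqxx|by right; split=> // e; apply: NN;
  rewrite e !eqxx orbT].
- exists a, k; split; rewrite 1?Esym //; first by rewrite !eqxx orbT.
  by left; split=> // e; apply: NN; rewrite e !eqxx orbT.
- exists b, k; split; rewrite 1?Esym //; first by rewrite !eqxx orbT.
  by right; split=> // e; apply: NN; rewrite e !eqxx.
Qed.

Let avoid_a := [exists d : 'I_n * 'I_n, [exists d' : 'I_n * 'I_n,
  [&& E d.1 d.2, E d'.1 d'.2, r d.1 d.2 < l d'.1 d'.2,
      d.1 != a :> nat, d.2 != a :> nat, d'.1 != a :> nat & d'.2 != a :> nat]]].

Let avoid_aP x y z w : E x y -> E z w -> r x y < l z w ->
  x <> a -> y <> a -> z <> a -> w <> a -> avoid_a.
Proof.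
move=> E1 E2 H /eqP n1 /eqP n2 /eqP n3 /eqP n4; apply/existsP.
exists (Ordinal (Eltn E1), Ordinal (Eltn2 E1)); apply/existsP.
by exists (Ordinal (Eltn E2), Ordinal (Eltn2 E2)); apply/and5P; split=> //=; apply/and3P.
Qed.

(* All pairs of edges at a become comparable in the chain; the other pairs with
   an edge at a are x < ac, ab < x, or the unique ab' < bb' and cc' < ac'. *)
Lemma star_case : ~~ avoid_a -> dominated n E l r.
Proof.
move=> /negP NA.
(* At most one vertex y has ay before by: for a second one z, az precedes by or ay precedes bz, and
   these edges have no common end. If there is none, b serves as a dummy b'. *)
have [b' [b'U b'E]] : exists b', (forall y, E a y -> E b y -> r a y < l b y -> y = b') /\
    (b' = b \/ [/\ E a b', E b b' & r a b' < l b b']).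
  case: (boolP [exists y : 'I_n, [&& E a y, E b y & r a y < l b y]]) =>
    [/existsP[y /and3P[E1 E2 H]]|/existsPn H].
    exists y; split; last by right.
    move=> z E3 E4 H'; case: (ltnP (r a z) (l b y)) => H3.
      by have := V1 E3 E2 H3; apply: meet_eq; neqE.
    have := V1 E1 E4 (leq_trans H (leq_trans H3 (ltnW H'))).
    by move=> M; apply/esym; apply: meet_eq M; neqE.
  exists b; split; last by left.
  by move=> y E1 E2 H'; have := H (Ordinal (Eltn2 E1)); rewrite /= E1 E2 H'.
(* Dually, at most one vertex y has cy before ay. *)
have [c' [c'U c'E]] : exists c', (forall y, E a y -> E c y -> r c y < l a y -> y = c') /\
    (c' = c \/ [/\ E a c', E c c' & r c c' < l a c']).
  case: (boolP [exists y : 'I_n, [&& E a y, E c y & r c y < l a y]]) =>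
    [/existsP[y /and3P[E1 E2 H]]|/existsPn H].
    exists y; split; last by right.
    move=> z E3 E4 H'; case: (ltnP (r c z) (l a y)) => H3.
      by have := V1 E4 E1 H3; apply: meet_eq; neqE.
    have := V1 E2 E3 (leq_trans H (leq_trans H3 (ltnW H'))).
    by move=> M; apply/esym; apply: meet_eq M; neqE.
  exists c; split; last by left.
  by move=> y E1 E2 H'; have := H (Ordinal (Eltn2 E1)); rewrite /= E1 E2 H'.
have b'c : b' <> c.
  case: b'E => [-> //|[E1 E2 H] e]; subst.
  by have := lmax E2; have := ler Eac; lia.
have c'b : c' <> b.
  case: c'E => [->|[E1 E2 H] e]; first by move=> e; apply: nbc.
  by subst; have := rmin E2; have := ler Eab; have := ler E2; lia.
(* Otherwise cc' precedes ac' = ab', which precedes bb', and the pair cc', bb' avoids a. *)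
have b'c' : b' <> c'.
  move=> e; subst; case: b'E => [//|[E1 E2 H]]; case: c'E => [//|[E3 E4 H']].
  apply: NA; apply: (@avoid_aP c c' b c') => //.
  - exact: leq_trans H' (leq_trans (ler E1) (ltnW H)).
  - by move=> e; apply: (Eneq Eac).
  - by move=> e; apply: (Eneq E1).
  - by move=> e; apply: (Eneq Eab).
  - by move=> e; apply: (Eneq E1).
set p := nth 0 [:: 0; a; b; c; b'; c'].
have [Ha [Hb Hc]] := (Eltn Eab, (Eltn2 Eab, Eltn2 Eac)).
have Hb' : b' < n by case: b'E => [->//|[/Eltn2]].
have Hc' : c' < n by case: c'E => [->//|[/Eltn2]].
exists p; split; [|exact: star_valid|].
  move=> k; apply: (@leq_trans n.+1); last by rewrite /base; nia.
  rewrite /p; case: (ltnP k 6) => Hk; last by rewrite nth_default.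
  by move: k Hk; do 6 (case=> [|] /=; first lia).
have D i j k h : E i j -> E k h -> r i j < l k h -> disj (lo n p) (hi n p) i j k h.
  move=> Ei Ek H.
  have [x [y [Exy lxy rxy sxy Fx]]] := left_form Ei Ek H.
  have [z [w [Ezw lzw rzw szw Fz]]] := right_form Ei Ek H.
  have -> : disj (lo n p) (hi n p) i j k h = disj (lo n p) (hi n p) x y z w.
    have e1 : lo n p i j = lo n p x y /\ hi n p i j = hi n p x y.
      by move: sxy; case/orP=> /andP[/eqP -> /eqP ->]; rewrite ?(lo_sym n p y) ?(hi_sym n p y).
    have e2 : lo n p k h = lo n p z w /\ hi n p k h = hi n p z w.
      by move: szw; case/orP=> /andP[/eqP -> /eqP ->]; rewrite ?(lo_sym n p w) ?(hi_sym n p w).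
    by rewrite /disj e1.1 e1.2 e2.1 e2.2.
  rewrite rxy lzw in H; rewrite /disj /lo /hi /=.
  have Hy := Eltn2 Exy; have Hw := Eltn2 Ezw.
  have nxy := Eneq Exy; have nzw := Eneq Ezw.
  have nab := Eneq Eab; have nac := Eneq Eac.
  have M := V1 Exy Ezw H; rewrite /meet in M.
  have /eqP p21 : p 2 <> p 1 by move=> e; apply: nab.
  have /eqP p31 : p 3 <> p 1 by move=> e; apply: nac.
  have /eqP p32 : p 3 <> p 2 by move=> e; apply: nbc.
  (* Two edges at a stand on distinct rungs. If ay precedes bw, then y is b, or y = w = b'. If cy
     precedes aw, then w is c, or y = w = c'. Finally cy before bw would avoid a. *)
  case: Fx => -[ex ny]; case: Fz => -[ez nw]; subst x z.
  - have nyw : y <> w.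
      by move=> e; subst; have := leq_ltn_trans (ler Exy) H; rewrite ltnn.
    have : ladder n p y <> ladder n p w by move=> /ladder_inj e; apply: nyw; apply: e.
    by rewrite /lo_star /hi_star /= !eqxx; clear; case: ltngtP.
  - case: (eqVneq y b) => [eyb|nyb].
      by subst y; rewrite (@star_first n p) //=; apply/eqP.
    have eyw : y = w by move: M nyb nab nw; clear; lia.
    subst y; have e := b'U _ Exy Ezw H; subst w.
    by rewrite (@star_second n p) //; rewrite /p //=; apply/eqP; congruence.
  - case: (eqVneq w c) => [ewc|nwc].
      by subst w; rewrite (@star_last n p) //=; apply/eqP.
    have eyw : y = w by move: M nwc nac ny; clear; lia.
    subst y; have e := c'U _ Ezw Exy H; subst w.
    by rewrite (@star_before_last n p) //; rewrite /p //=; apply/eqP; congruence.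
  - by exfalso; apply: NA; apply: (avoid_aP Exy Ezw H); congruence.
apply: leq_sum => d Ed; apply: leq_sum => d' Ed'.
suff: disj l r d.1 d.2 d'.1 d'.2 -> disj (lo n p) (hi n p) d.1 d.2 d'.1 d'.2.
  by case: (disj l r _ _ _ _) => // ->.
case/orP=> H; first exact: D.
by rewrite /disj orbC; apply: D.
Qed.

Hypotheses (lbound : forall i j, l i j <= n * n) (rbound : forall i j, r i j <= n * n).

Let outside z y := [&& y != a, y != b, y != c & y != z].

(** By [left_form] and [right_form] every comparable pair has one end of each edge in {a, b, c}, so
    the hypothesis of [table_case] concerns only the two other ends. *)
Let outside_case z : z < n ->
  (forall x y w y', x = a \/ x = c -> w = a \/ w = b -> E x y -> E w y' ->
     r x y < l w y' -> outside z y -> outside z y' -> False) ->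
  dominated n E l r.
Proof.
move=> Hz H; apply: (@table_case n E Esym Eltn l r lsym rsym ler V lbound rbound a b c z
  (Eltn Eab) (Eltn2 Eab) (Eltn2 Eac) Hz).
move=> i j k h Ei Ek Hlt.
have [x [y [Exy lxy rxy sxy Fx]]] := left_form Ei Ek Hlt.
have [w [y' [Ew lw rw sw Fw]]] := right_form Ei Ek Hlt.
set q := nth 0 [:: 1; a; b; c; z].
have clsP v : (cls q v < 4) = ~~ outside z v.
  by rewrite /cls /= /outside; clear; do 4 (case: eqP => //= _).
have inside i' j' x' y'' : same i' j' x' y'' -> x' = a \/ x' = b \/ x' = c ->
    (cls q i' < 4) && (cls q j' < 4) = ~~ outside z y''.
  move=> s hx; have {}hx : outside z x' = false.
    by rewrite /outside; case: hx => [->|[]->]; rewrite eqxx ?andbF.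
  by move: s; case/orP=> /andP[/eqP -> /eqP ->]; rewrite !clsP hx ?andbT.
rewrite (inside _ _ _ _ sxy) ?(inside _ _ _ _ sw); last 2 first.
- by case: Fw => -[-> _]; [left|right; left].
- by case: Fx => -[-> _]; [left|right; right].
rewrite -negb_and; apply/negP => /andP[o1 o2].
apply: (H x y w y') => //; last by rewrite -rxy -lw.
- by case: Fx => -[-> _]; [left|right].
- by case: Fw => -[-> _]; [left|right].
Qed.

Let twin y := [&& E c y, E b y & r c y < l b y].

Let nab : a != b. Proof. by apply/eqP; apply: Eneq. Qed.
Let nac : a != c. Proof. by apply/eqP; apply: Eneq. Qed.
Let nbc' : b != c. Proof. by apply/eqP. Qed.

Let lt_ac_l i j k h : E i j -> E k h -> r i j < l k h -> ~~ same i j a c.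
Proof.
move=> Ei Ek H; have L := leq_trans H (lmax Ek); have L' := ler Eac.
apply/negP; case/orP=> /andP[/eqP e /eqP e']; subst; move: L; rewrite ?(rsym c a) ltnNge L' //.
Qed.

Let lt_ab_r i j k h : E i j -> E k h -> r i j < l k h -> ~~ same k h a b.
Proof.
move=> Ei Ek H; have L := leq_ltn_trans (rmin Ei) H; have L' := ler Eab.
apply/negP; case/orP=> /andP[/eqP e /eqP e']; subst; move: L; rewrite ?(lsym b a) ltnNge L' //.
Qed.

(** A comparable pair avoiding a has the form cy before by'. The edges meet, so y = y', y = b or y'
    = c, which gives the three shapes. *)
Let avoid_forms : avoid_a -> exists z, [/\ z < n, z != a, z != b, z != c &
  [\/ twin z, [&& E b c, E b z & r b c < l b z] | [&& E c z, E b c & r c z < l b c]]].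
Proof.
case/existsP=> -[d1 d2] /existsP[[d3 d4]] /= /and5P[E1 E2 H n1 /and3P[n2 n3 n4]].
have [x [y [Exy lxy rxy sxy Fx]]] := left_form E1 E2 H.
have [w [y' [Ew lw rw sw Fw]]] := right_form E1 E2 H.
have ec : x = c /\ y != a.
  by move: sxy Fx n1 n2; rewrite /same; clear; lia.
have eb : w = b /\ y' != a.
  by move: sw Fw n3 n4; rewrite /same; clear; lia.
case: ec eb => ? ny [? ny']; subst x w.
rewrite rxy lw in H.
have /eqP cy := Eneq Exy; have /eqP by' := Eneq Ew.
have M := V1 Exy Ew H.
case: (eqVneq y y') => [e|nyy].
  subst y'; exists y; split=> //; rewrite 1?eq_sym ?(Eltn2 Exy) //.
  by apply: Or31; rewrite /twin Exy Ew.
case: (eqVneq y b) => [e|nyb].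
  subst y; exists y'; split=> //; rewrite 1?eq_sym ?(Eltn2 Ew) //; last first.
    by apply: Or32; rewrite Esym Exy Ew (rsym b c).
  by apply: contraTneq H => <-; rewrite (lsym b c) -leqNgt; apply: ler.
have ey' : y' = c by move: M nyy nyb nbc'; rewrite /meet; clear; lia.
subst y'; exists y; split=> //; rewrite 1?eq_sym ?(Eltn2 Exy) //.
by apply: Or33; rewrite Exy Ew.
Qed.

(* Of two pairs x < y and u < v one has x < v or u < y; applied to a pair
   avoiding a, this confines every other pair to {a, b, c, z}, for z chosen
   according to the shape of that pair. *)
Lemma avoid_case : avoid_a -> dominated n E l r.
Proof.
case/avoid_forms=> z0 [Hz0 za0 zb0 zc0 Fz0].
case: (boolP [exists z : 'I_n, [&& z != a :> nat, z != b :> nat, z != c :> nat & twin z]]) =>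
  [/existsP[z]|/existsPn Ntwin].
  (* Against cz before bz, an outside pair xy before wy' gives xy before bz or cz before wy', and
     neither pair has a common end. *)
  case/and4P=> za zb zc /and3P[E1 E2 H]; apply: (@outside_case z) => //.
  move=> x y w y' hx hw Ex Ew Hxw /and4P[oa ob oc oz] /and4P[oa' ob' oc' oz'].
  case: (ltnP (r x y) (l b z)) => C.
    have := V1 Ex E2 C.
    by case: hx => ->; apply: meetF; neq.
  have := V1 E1 Ew (leq_trans H (leq_trans C (ltnW Hxw))).
  by case: hw => ->; apply: meetF; neq.
have {}Ntwin y : y != a -> y != b -> y != c -> E c y -> E b y -> r c y < l b y -> False.
  move=> y1 y2 y3 E1 E2 H; have := Ntwin (Ordinal (Eltn2 E1)).
  by rewrite /= y1 y2 y3 /twin E1 E2 H.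
case: Fz0 => [/and3P[E1 E2 H]|/and3P[Ebc E2 H]|/and3P[E1 Ebc H]].
- by case: (Ntwin z0).
(* Here bc precedes bz. An outside pair must then be ay before by for one vertex y; in that case z
   is assumed to satisfy az before bz too, and y and z clash. *)
- have main z : z < n -> z != a -> z != b -> z != c -> E b z -> r b c < l b z ->
    (forall y, E a y -> E b y -> r a y < l b y -> E a z /\ r a z < l b z) ->
    dominated n E l r.
    move=> Hz za zb zc Ebz Hbz Hy; apply: (@outside_case z) => //.
    move=> x y w y' hx hw Ex Ew Hxw /and4P[oa ob oc oz] /and4P[oa' ob' oc' oz'].
    case: (ltnP (r x y) (l b z)) => C.
      have := V1 Ex Ebz C.
      by case: hx => ->; apply: meetF; neq.
    have M := V1 Ebc Ew (leq_trans Hbz (leq_trans C (ltnW Hxw))).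
    case: hw => ew; subst w; first by apply: meetF M; neq.
    have ey : y = y' by have := V1 Ex Ew Hxw; case: hx => ->; apply: meet_eq; neq.
    subst y'; case: hx => ex; subst x; last exact: (Ntwin y).
    have [Eaz Haz] := Hy _ Ex Ew Hxw.
    case: (ltnP (r a z) (l b y)) => C2.
      by have := V1 Eaz Ew C2; apply: meetF; neq.
    have := V1 Ex Ebz (leq_trans Hxw (leq_trans C2 (ltnW Haz))).
    by apply: meetF; neq.
  case: (boolP [exists y : 'I_n, [&& E a y, E b y & r a y < l b y]]) =>
    [/existsP[y /and3P[Ey1 Ey2 Hy]]|/existsPn N].
    have yc : y != c :> nat.
      by have := lt_ac_l Ey1 Ey2 Hy; rewrite /same eqxx /=; case: eqP.
    have ya : y != a :> nat by rewrite eq_sym; apply/eqP; apply: Eneq.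
    have yb : y != b :> nat by rewrite eq_sym; apply/eqP; apply: Eneq.
    apply: (main y) => //.
    (* If ay precedes bz0 then y = z0; otherwise bc ends before bz0 begins, hence before ay ends and
       before by begins. *)
    case: (ltnP (r a y) (l b z0)) => C; last exact: leq_trans H (leq_trans C (ltnW Hy)).
    suff -> : nat_of_ord y = z0 by [].
    by have := V1 Ey1 E2 C; apply: meet_eq; neq.
  apply: (main z0) => // y Ey1 Ey2 Hy.
  by have := N (Ordinal (Eltn2 Ey1)); rewrite /= Ey1 Ey2 Hy.
(* The mirror image: reversing the line exchanges b and c. *)
have main z : z < n -> z != a -> z != b -> z != c -> E c z -> r c z < l b c ->
    (forall y, E a y -> E c y -> r c y < l a y -> E a z /\ r c z < l a z) ->
    dominated n E l r.
  move=> Hz za zb zc Ecz Hcz Hy; apply: (@outside_case z) => //.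
  move=> x y w y' hx hw Ex Ew Hxw /and4P[oa ob oc oz] /and4P[oa' ob' oc' oz'].
  case: (ltnP (r c z) (l w y')) => C.
    have := V1 Ecz Ew C.
    by case: hw => ->; apply: meetF; neq.
  have M := V1 Ex Ebc (leq_trans Hxw (leq_trans C (ltnW Hcz))).
  case: hx => ex; subst x; first by apply: meetF M; neq.
  have ey : y = y' by have := V1 Ex Ew Hxw; case: hw => ->; apply: meet_eq; neq.
  subst y'; case: hw => ew; subst w; last exact: (Ntwin y).
  have [Eaz Haz] := Hy _ Ew Ex Hxw.
  case: (ltnP (r c z) (l a y)) => C2.
    by have := V1 Ecz Ew C2; apply: meetF; neq.
  have := V1 Ex Eaz (leq_trans Hxw (leq_trans C2 (ltnW Haz))).
  by apply: meetF; neq.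
case: (boolP [exists y : 'I_n, [&& E a y, E c y & r c y < l a y]]) =>
  [/existsP[y /and3P[Ey1 Ey2 Hy]]|/existsPn N].
  have yb : y != b :> nat.
    by have := lt_ab_r Ey2 Ey1 Hy; rewrite /same eqxx /=; case: eqP.
  have ya : y != a :> nat by rewrite eq_sym; apply/eqP; apply: Eneq.
  have yc : y != c :> nat by rewrite eq_sym; apply/eqP; apply: Eneq.
  apply: (main y) => //.
  case: (ltnP (r c z0) (l a y)) => C; last exact: leq_trans Hy (leq_trans C (ltnW H)).
  suff -> : nat_of_ord y = z0 by [].
  by have := V1 E1 Ey1 C => /(meet_eq _ _ _) M; apply/esym/M; neq.
apply: (main z0) => // y Ey1 Ey2 Hy.
by have := N (Ordinal (Eltn2 Ey1)); rewrite /= Ey1 Ey2 Hy.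
Qed.

End Given.

Lemma candidate_dominates (l r : nat -> nat -> nat) :
  (forall i j, l i j = l j i) -> (forall i j, r i j = r j i) ->
  (forall i j, E i j -> l i j <= r i j) -> valid E l r ->
  (forall i j, l i j <= n * n) -> (forall i j, r i j <= n * n) ->
  dominated n E l r.
Proof.
move=> lsym rsym ler V lb rb.
(* Without disjoint pairs any valid candidate will do; the zero vector is one of the star kind. *)
rewrite /dominated; case: (posnP (disj_count n E l r)) => [->|pos].
  exists (fun=> 0); split=> //; last exact: star_valid.
  by move=> k; rewrite /base addn2.
have [i [j [k [h [Ei Ek Hlt]]]]] : exists i j k h, [/\ E i j, E k h & r i j < l k h].
  have : [exists d : 'I_n * 'I_n, [exists d' : 'I_n * 'I_n,
      [&& E d.1 d.2, E d'.1 d'.2 & disj l r d.1 d.2 d'.1 d'.2]]].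
    apply: contraLR pos => /existsPn N; rewrite -eqn0Ngt; apply/eqP.
    apply: big1 => d Ed; apply: big1 => d' Ed'.
    have := N d; move/existsPn/(_ d'); rewrite Ed Ed' /=.
    by case: (disj _ _ _ _ _ _).
  case/existsP=> d /existsP[d' /and3P[Ed Ed' /orP[H|H]]].
    by exists d.1, d.2, d'.1, d'.2.
  by exists d'.1, d'.2, d.1, d.2.
pose P := [pred d : 'I_n * 'I_n | E d.1 d.2].
pose d0 : 'I_n * 'I_n := (Ordinal (Eltn Ei), Ordinal (Eltn2 Ei)).
have P0 : P d0 by [].
have [[a1 b1] Eab rmin] := arg_minnP (fun d : 'I_n * 'I_n => r d.1 d.2) P0.
have [[a2 c2] Eac lmax] := arg_maxnP (fun d : 'I_n * 'I_n => l d.1 d.2) P0.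
rewrite /P /= in Eab Eac rmin lmax.
have rmin' x y : E x y -> r a1 b1 <= r x y.
  by move=> Exy; apply: (rmin (Ordinal (Eltn Exy), Ordinal (Eltn2 Exy))).
have lmax' x y : E x y -> l x y <= l a2 c2.
  by move=> Exy; apply: (lmax (Ordinal (Eltn Exy), Ordinal (Eltn2 Exy))).
have ab_ac : r a1 b1 < l a2 c2.
  by have := rmin' _ _ Ei; have := lmax' _ _ Ek; lia.
have M : meet a1 b1 a2 c2 by apply: V => //; rewrite /disj ab_ac.
(* The edge ending first and the edge beginning last share an end by validity; it is named a. *)
have [a [b [c [Eab' Eac' eab eac]]]] : exists a b c, [/\ E a b, E a c,
  r a1 b1 = r a b & l a2 c2 = l a c].
  move: M; rewrite /meet -!orbA; case/or4P=> /eqP e.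
  - by exists a1, b1, c2; split=> //; rewrite e.
  - by exists a1, b1, a2; split=> //; rewrite e; [rewrite Esym|rewrite lsym].
  - by exists b1, a1, c2; split; [rewrite Esym|rewrite e|rewrite rsym|rewrite e].
  - by exists b1, a1, a2; split; [rewrite Esym|rewrite e Esym|rewrite rsym|rewrite e lsym].
rewrite eab in rmin' ab_ac; rewrite eac in lmax' ab_ac.
case: (boolP [exists d : 'I_n * 'I_n, [exists d' : 'I_n * 'I_n,
  [&& E d.1 d.2, E d'.1 d'.2, r d.1 d.2 < l d'.1 d'.2,
      d.1 != a :> nat, d.2 != a :> nat, d'.1 != a :> nat & d'.2 != a :> nat]]]) => A.
  exact: (@avoid_case l r lsym rsym ler V a b c).
exact: (@star_case l r lsym rsym ler V a b c).
Qed.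

End Combinatorics.

(** * Correctness of the search *)

Lemma digit_encoding B D (p : nat -> nat) : (forall k, p k < B) ->
  exists2 x, x < B ^ D & forall k, k < D -> x %/ B ^ k %% B = p k.
Proof.
elim: D p => [|D IH] p Hp; first by exists 0.
have B0 : 0 < B by apply: leq_trans (Hp 0).
have [x Hx Hd] := IH (p \o S) (fun k => Hp k.+1).
exists (x * B + p 0).
  by rewrite expnS; have := Hp 0; move: Hx; clear; nia.
case=> [|k] Hk; first by rewrite expn0 divn1 modnMDl modn_small.
by rewrite expnS divnMA divnMDl // (divn_small (Hp 0)) addn0 Hd.
Qed.

Lemma lo_ext n p p' i j : (forall k, k < 56 -> p k = p' k) -> lo n p i j = lo n p' i j.
Proof.
move=> H; rewrite /lo /lo_star /ladder /cls2 /cls !H //; case: ifP => // _.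
by rewrite /table; apply: eq_big_seq => t; rewrite mem_iota => Ht; rewrite H //; lia.
Qed.

Lemma hi_ext n p p' i j : (forall k, k < 56 -> p k = p' k) -> hi n p i j = hi n p' i j.
Proof.
move=> H; rewrite /hi /hi_star /ladder /cls2 /cls !H //; case: ifP => // _.
by rewrite /table; congr (_ + _); apply: eq_big_seq => t; rewrite mem_iota => Ht; rewrite H //; lia.
Qed.

Lemma nsum_eq0 T (F : nat -> bool) : reflect (forall x, x < T -> ~~ F x) (nsum T F == 0).
Proof.
rewrite /nsum sum_nat_eq0; apply: (iffP forallP) => [H x Hx|H x].
  by have := H (Ordinal Hx); rewrite /= eqb0.
by rewrite /= eqb0 H.
Qed.

Section Best.
Variables (n : nat) (m : nat -> nat).

Lemma best_max : best n m < base n ^ 56 /\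
  forall y, y < base n ^ 56 -> score n m y <= score n m (best n m).
Proof.
set T := base n ^ 56.
have T0 : 0 < T by rewrite expn_gt0 /base addn2.
have ex : exists x, (x < T) && is_best n m x.
  have [x _ Hx] := @arg_maxnP _ (Ordinal T0) xpredT (fun x : 'I_T => score n m x) isT.
  exists x; rewrite ltn_ord; apply/nsum_eq0 => y Hy.
  by rewrite -leqNgt; apply: (Hx (Ordinal Hy)).
have [x0 /andP[xT xb] xmin] := ex_minnP ex.
suff -> : best n m = x0.
  by split=> // y Hy; rewrite leqNgt; move/nsum_eq0: xb; apply.
apply: nsum_ltn; first exact: ltnW.
move=> x Hx; apply/nsum_eq0/idP => [H|H y Hy].
  by rewrite ltnNge; apply/negP => H'; move: (H x0); rewrite ltnS => /(_ H') /negP.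
apply/negP => yb; have := xmin y; rewrite yb andbT => /(_ _).
by move=> /(_ (leq_trans Hy Hx)); rewrite leqNgt (leq_trans Hy).
Qed.

End Best.

Lemma sum4_ext n m m' F : (forall i j, i < n -> j < n -> m (i * n + j) = m' (i * n + j)) ->
  sum4 n m F = sum4 n m' F.
Proof.
move=> H; rewrite /sum4 /nsum; apply: eq_bigr => i _; apply: eq_bigr => j _.
by apply: eq_bigr => k _; apply: eq_bigr => h _; rewrite !H.
Qed.

Lemma best_ext n m m' : (forall i j, i < n -> j < n -> m (i * n + j) = m' (i * n + j)) ->
  best n m = best n m'.
Proof.
move=> H; have S c : score n m c = score n m' c by rewrite /score !(sum4_ext _ H).
rewrite /best /nsum; apply: eq_bigr => x _; congr nat_of_bool; congr (_ == _).
apply: eq_bigr => y _; congr nat_of_bool; rewrite /is_best /nsum; congr (_ == _).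
by apply: eq_bigr => z _; rewrite !S.
Qed.

(** Every entry is recomputed while the memory is being written; it depends only on the input
    matrix, which stays intact. *)
Lemma output_ext n m m' x : (forall i j, i < n -> j < n -> m (i * n + j) = m' (i * n + j)) ->
  output n m x = output n m' x.
Proof. by move=> H; rewrite /output (best_ext H). Qed.

(** * Edges as ordered pairs of vertices, and intervals on edges *)

Lemma set2_same (T : finType) (i j k h : T) :
  ([set i; j] == [set k; h]) = (i == k) && (j == h) || (i == h) && (j == k).
Proof.
apply/eqP/idP => [e|]; last first.
  by case/orP=> /andP[/eqP -> /eqP ->] //; rewrite setUC.
have := set21 i j; rewrite e !inE => H1; have := set22 i j; rewrite e !inE => H2.
have := set21 k h; rewrite -e !inE => H3; have := set22 k h; rewrite -e !inE => H4.
move: H1 H2 H3 H4; rewrite ![k == _]eq_sym ![h == _]eq_sym.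
by case: (i == k); case: (j == h); case: (i == h); case: (j == k).
Qed.

Section Darts.
Variables (T : finType) (G : sgraph T).

Lemma edgesE i j : ([set i; j] \in edges G) = G i j.
Proof.
apply/imsetP/idP => [[[k h]]|H]; last by exists (i, j); rewrite ?inE.
rewrite inE /= => H /eqP; rewrite set2_same.
by case/orP=> /andP[/eqP -> /eqP ->] //; rewrite adj_sym.
Qed.

Lemma edge_ends (e : edge_type G) : exists i j, G i j /\ val e = [set i; j].
Proof.
case: e => /= e /imsetP[[i j]]; rewrite inE /= => H ->.
by exists i, j.
Qed.

(** As there are no loops, an edge is [[set i; j]] for exactly two ordered pairs. *)
Lemma dart_sum (H : T * T -> nat) (h : edge_type G -> nat) :
  (forall e i j, val e = [set i; j] -> H (i, j) = h e) ->
  \sum_(d : T * T | G d.1 d.2) H d = 2 * \sum_e h e.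
Proof.
move=> Hh.
have unique (d : T * T) : G d.1 d.2 ->
    H d = \sum_(e : edge_type G | val e == [set d.1; d.2]) h e.
  move=> Gd; have Ed : [set d.1; d.2] \in edges G by rewrite edgesE.
  pose e0 : edge_type G := exist _ [set d.1; d.2] Ed.
  rewrite (big_pred1 e0); last first.
    by move=> e; apply/eqP/eqP => [He|->] //; apply: val_inj.
  by rewrite -(Hh e0 d.1 d.2 erefl); case: (d).
rewrite (eq_bigr _ unique) (exchange_big_dep xpredT) //= big_distrr /=.
apply: eq_bigr => e _; rewrite sum_nat_const; congr (_ * _).
have [i [j [Gij ee]]] := edge_ends e.
have nij : i != j by apply: contraTneq Gij => ->; rewrite adj_irr.
rewrite -[RHS](_ : #|[set (i, j); (j, i)]| = 2); last by rewrite cards2 xpair_eqE (negbTE nij).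
apply: eq_card => -[k k']; rewrite unfold_in !inE /= ee set2_same !xpair_eqE /=.
rewrite [k == i]eq_sym [k' == j]eq_sym [k == j]eq_sym [k' == i]eq_sym [(j == k) && _]andbC.
apply: andb_idl; case/orP=> /andP[/eqP <- /eqP <-] //.
by rewrite adj_sym.
Qed.

Lemma card_darts : \sum_(d : T * T | G d.1 d.2) 1 = 2 * #|edges G|.
Proof.
by rewrite (@dart_sum _ (fun=> 1)) // sum1_card card_sig.
Qed.

End Darts.

Section EdgeIntervals.
Variables (n : nat) (G : sgraph 'I_n).
Local Notation edge := (edge_type G).

(** Adjacency on [nat], false outside the vertex range: candidates treat vertices as numbers. *)
Definition nadj (i j : nat) : bool :=
  [exists d : 'I_n * 'I_n, [&& d.1 == i :> nat, d.2 == j :> nat & G d.1 d.2]].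

Lemma nadj_ord (i j : 'I_n) : nadj i j = G i j.
Proof.
apply/existsP/idP => [[[k h] /= /and3P[/eqP/val_inj-> /eqP/val_inj->]]|H] //.
by exists (i, j); rewrite !eqxx.
Qed.

Lemma nadjP i j : nadj i j -> exists i' j' : 'I_n, [/\ i = i', j = j' & G i' j'].
Proof. by case/existsP=> -[k h] /and3P[/eqP<- /eqP<- H]; exists k, h. Qed.

Lemma nadj_sym : symmetric nadj.
Proof.
have S i j : nadj i j -> nadj j i.
  by move=> /nadjP[i' [j' [-> -> H]]]; rewrite nadj_ord adj_sym.
by move=> i j; apply/idP/idP; apply: S.
Qed.

Lemma nadj_irr : irreflexive nadj.
Proof.
move=> i; apply/negbTE/negP => /nadjP[i' [j' [-> /val_inj <-]]].
by rewrite adj_irr.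
Qed.

Lemma nadj_ltn i j : nadj i j -> i < n.
Proof. by case/nadjP=> i' [j' [-> _ _]]. Qed.

Lemma sum_darts2 (F : nat -> nat -> nat -> nat -> bool) (f : edge -> edge -> bool) :
  (forall (e e' : edge) (i j k h : 'I_n), val e = [set i; j] -> val e' = [set k; h] ->
     F i j k h = f e e') ->
  \sum_(d : 'I_n * 'I_n | nadj d.1 d.2) \sum_(d' : 'I_n * 'I_n | nadj d'.1 d'.2)
     F d.1 d.2 d'.1 d'.2 = 4 * \sum_e \sum_e' f e e'.
Proof.
move=> Ff.
have D (H : 'I_n * 'I_n -> nat) :
    \sum_(d : 'I_n * 'I_n | nadj d.1 d.2) H d = \sum_(d : 'I_n * 'I_n | G d.1 d.2) H d.
  by apply: eq_bigl => d; rewrite nadj_ord.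
rewrite D (@dart_sum _ G _ (fun e => 2 * \sum_e' f e e')).
  by rewrite -big_distrr mulnA.
move=> e i j He; rewrite D; apply: dart_sum => e' k h He'.
by rewrite (Ff _ _ _ _ _ _ He He').
Qed.

Lemma sum4_darts (m : nat -> nat) F : (forall i j : 'I_n, m (i * n + j) = G i j) ->
  sum4 n m F = \sum_(d : 'I_n * 'I_n | nadj d.1 d.2)
    \sum_(d' : 'I_n * 'I_n | nadj d'.1 d'.2) F d.1 d.2 d'.1 d'.2.
Proof.
move=> Hm; rewrite /sum4 /nsum pair_bigA /= [RHS]big_mkcond /=; apply: eq_bigr => d _.
rewrite pair_bigA /= nadj_ord; case: ifP => Gd.
- rewrite [RHS]big_mkcond; apply: eq_bigr => d' _.
  by rewrite nadj_ord !Hm Gd; case: (G _ _); rewrite ?mul1n.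
- by apply: big1 => d' _; rewrite Hm Gd.
Qed.

Lemma meet_set (i j k h : 'I_n) : meet i j k h = ([set i; j] :&: [set k; h] != set0).
Proof.
apply/idP/set0Pn => [|[x]].
  rewrite /meet -!orbA; case/or4P=> /eqP/val_inj e.
  - by exists i; rewrite !inE e !eqxx.
  - by exists i; rewrite !inE e !eqxx !orbT.
  - by exists j; rewrite !inE e !eqxx !orbT.
  - by exists j; rewrite !inE e !eqxx !orbT.
rewrite !inE /meet => /andP[/orP[]/eqP-> /orP[]/eqP->]; rewrite eqxx ?orbT //.
Qed.

Lemma same_set (i j k h : 'I_n) : same i j k h = ([set i; j] == [set k; h]).
Proof. by rewrite set2_same. Qed.

Section FromDarts.
Variables (l r : nat -> nat -> nat).
Hypotheses (lsym : forall i j, l i j = l j i) (rsym : forall i j, r i j = r j i).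
Hypothesis ler : forall i j, l i j <= r i j.

Let ends_ex (e : edge) : exists d : 'I_n * 'I_n, val e == [set d.1; d.2].
Proof. by have [i [j [_ H]]] := edge_ends e; exists (i, j); rewrite /= H. Qed.

Definition edge_val (f : nat -> nat -> nat) (e : edge) : nat :=
  f (xchoose (ends_ex e)).1 (xchoose (ends_ex e)).2.

Lemma edge_valE f e (i j : 'I_n) : (forall i j, f i j = f j i) ->
  val e = [set i; j] -> edge_val f e = f i j.
Proof.
move=> fs He; rewrite /edge_val; have := xchooseP (ends_ex e).
move: (xchoose _) => d; rewrite He set2_same.
by case/orP=> /andP[/eqP <- /eqP <-].
Qed.

Definition edge_disj (e e' : edge) : bool :=
  (edge_val r e < edge_val l e') || (edge_val r e' < edge_val l e).

Lemma edge_disjE (e e' : edge) (i j k h : 'I_n) :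
  val e = [set i; j] -> val e' = [set k; h] -> disj l r i j k h = edge_disj e e'.
Proof.
by move=> He He'; rewrite /edge_disj !(edge_valE _ He) // !(edge_valE _ He').
Qed.

Definition overlap : rel edge := fun e e' => (e != e') && ~~ edge_disj e e'.

Lemma overlap_sym : symmetric overlap.
Proof. by move=> e e'; rewrite /overlap /edge_disj eq_sym orbC. Qed.

Lemma overlap_irr : irreflexive overlap.
Proof. by move=> e; rewrite /overlap eqxx. Qed.

Definition overlap_graph : sgraph edge := SGraph overlap_sym overlap_irr.

Lemma overlap_completion (R : realType) : valid nadj l r ->
  interval_completion R (compl_graph (line_graph G)) overlap_graph.
Proof.
move=> V; split.
  move=> e e' /= /andP[ne Nl]; rewrite /overlap ne /=; apply: contra Nl => D.
  rewrite /= /line_adj ne /=.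
  have [i [j [Gij He]]] := edge_ends e; have [k [h [Gkh He']]] := edge_ends e'.
  rewrite He He' -meet_set; apply: V; rewrite ?nadj_ord //.
  by rewrite (edge_disjE He He').
exists (fun e => ((edge_val l e)%:R)%R), (fun e => ((edge_val r e)%:R)%R); split.
  move=> e; rewrite Num.Theory.ler_nat.
  exact: ler.
move=> e e' ne /=; rewrite /overlap ne /= /edge_disj negb_or -!leqNgt; split.
  (* The larger of the two left ends is a common point. *)
  case/andP=> H1 H2; exists ((maxn (edge_val l e) (edge_val l e'))%:R)%R.
  rewrite !interval.in_itv /= !Num.Theory.ler_nat !geq_max !leq_maxl !leq_maxr H1 H2 /=.
  by rewrite !ler.
case=> x; rewrite !interval.in_itv /= => -[/andP[a b] /andP[c d]].
by rewrite -!(Num.Theory.ler_nat R) (Order.POrderTheory.le_trans c b)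
  (Order.POrderTheory.le_trans a d).
Qed.

Lemma disj_count_edges : disj_count n nadj l r = 4 * \sum_e \sum_e' edge_disj e e'.
Proof. by apply: sum_darts2 => e e' i j k h; apply: edge_disjE. Qed.

End FromDarts.

(** Ordered pairs of edges are adjacent in [K], disjoint, or equal. Minimising the edges of [K] thus
    amounts to maximising the disjoint pairs. *)
Lemma card_edges_disj (K : sgraph edge) (f : rel edge) :
  (forall e e', K e e' = (e != e') && ~~ f e e') -> (forall e, ~~ f e e) ->
  2 * #|edges K| + \sum_e \sum_e' f e e' + #|edge| = #|edge| * #|edge|.
Proof.
move=> HK Hf; rewrite -card_darts big_mkcond /=.
rewrite -(pair_big xpredT xpredT (fun e e' => if K e e' then 1 else 0)) /=.
have {1}-> : #|edge| = \sum_(e : edge) \sum_(e' : edge) (e == e').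
  rewrite -sum1_card; apply: eq_bigr => e _.
  by rewrite (bigD1 e) //= eqxx big1 ?addn0 // => e' /negbTE; rewrite eq_sym => ->.
rewrite -sum_nat_const -big_split -big_split /=; apply: eq_bigr => e _.
rewrite -big_split -big_split /= -sum1_card; apply: eq_bigr => e' _.
by rewrite HK; case: eqP => [->|_] /=; [rewrite (negbTE (Hf e'))|case: (f e e')].
Qed.

End EdgeIntervals.

(** * Optimality of the best candidate *)

Section Optimality.
Variables (n : nat) (G : sgraph 'I_n).
Local Notation edge := (edge_type G).

Let is_dart (i j : nat) (e : edge) := [exists d : 'I_n * 'I_n,
  [&& d.1 == i :> nat, d.2 == j :> nat & val e == [set d.1; d.2]]].

Definition dart_val (u : edge -> nat) (i j : nat) : nat :=
  if [pick e | is_dart i j e] is Some e then u e else 0.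

Lemma dart_valE u (e : edge) (i j : 'I_n) : val e = [set i; j] -> dart_val u i j = u e.
Proof.
move=> He; rewrite /dart_val; case: pickP => [e'|/(_ e)/existsP[]]; last first.
  by exists (i, j); rewrite /= He !eqxx.
case/existsP=> -[k h] /= /and3P[/eqP/val_inj-> /eqP/val_inj-> /eqP He'].
by congr u; apply: val_inj; exact: etrans He' (esym He).
Qed.

Lemma dart_val_sym u i j : dart_val u i j = dart_val u j i.
Proof.
rewrite /dart_val; congr (if _ is Some e then _ else _); apply: eq_pick => e.
by apply/existsP/existsP => -[[k h] /= /and3P[H1 H2 H3]]; exists (h, k); rewrite /= H1 H2 setUC.
Qed.

Lemma dart_val_le u B i j : (forall e, u e <= B) -> dart_val u i j <= B.
Proof. by move=> H; rewrite /dart_val; case: pickP. Qed.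

Lemma card_edge_le : #|edge| <= n * n.
Proof.
rewrite card_sig; apply: leq_trans (leq_imset_card _ _) _.
by apply: leq_trans (max_card _) _; rewrite card_prod card_ord.
Qed.

Lemma compl_line_disjoint (e e' : edge) :
  e != e' -> val e :&: val e' == set0 -> compl_graph (line_graph G) e e'.
Proof. by move=> ne H; rewrite /= /compl_adj ne /= /line_adj ne H. Qed.

Lemma best_candidate_optimal (R : realType) (m : nat -> nat) (c := best n m)
    (l := lo n (digit n c)) (r := hi n (digit n c)) :
  (forall i j : 'I_n, m (i * n + j) = G i j) ->
  min_interval_completion R (compl_graph (line_graph G)) (overlap_graph G l r).
Proof.
move=> Hm; set E := nadj G.
have [cT cmax] := best_max n m.
have Esym : symmetric E by apply: nadj_sym.
have Eirr : irreflexive E by apply: nadj_irr.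
have Eltn : forall i j, E i j -> i < n by move=> i j; apply: nadj_ltn.
have scoreE x : valid E (lo n (digit n x)) (hi n (digit n x)) ->
    score n m x = (disj_count n E (lo n (digit n x)) (hi n (digit n x))).+1.
  move=> V; rewrite /score (sum4_darts _ Hm) big1 ?eqxx.
    by rewrite (sum4_darts _ Hm).
  move=> d Ed; apply: big1 => d' Ed'; rewrite /cdisj.
  by case D: (disj _ _ _ _ _ _) => //=; rewrite (V _ _ _ _ Ed Ed' D).
have valid_score x : 0 < score n m x -> valid E (lo n (digit n x)) (hi n (digit n x)).
  rewrite /score; case: ifP => // H _ i j k h Ei Ek D; apply: contraTT H => N.
  have [i' [j' [ei ej Gi]]] := nadjP Ei; have [k' [h' [ek eh Gk]]] := nadjP Ek; subst.
  rewrite (sum4_darts _ Hm) (bigD1 (i', j')) ?nadj_ord //=.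
  by rewrite (bigD1 (k', h')) ?nadj_ord //= /cdisj D N.
(* Code 0 is the zero vector, valid as a star candidate, so the best score is positive and the best
   candidate valid. *)
have V : valid E l r.
  apply: valid_score; apply: leq_trans (cmax 0 _); last by rewrite expn_gt0 /base addn2.
  rewrite scoreE //; apply: star_valid => //.
  by rewrite /digit div0n mod0n.
have lsym i j : l i j = l j i := lo_sym _ _ _ _.
have rsym i j : r i j = r j i := hi_sym _ _ _ _.
have ler i j : l i j <= r i j := lo_le_hi _ _ _ _.
split; first exact: overlap_completion.
move=> K' [Hc [l' [r' [le' HK']]]].
pose dj e e' := (r' e < l' e')%R || (r' e' < l' e)%R.
have K'E e e' : K' e e' = (e != e') && ~~ dj e e'.
  case: eqVneq => [->|ne] /=; first by rewrite adj_irr.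
  apply/idP/idP => [/(HK' _ _ ne)[x]|].
    rewrite !interval.in_itv /= => -[/andP[a b] /andP[a' b']].
    rewrite negb_or -!Order.TotalTheory.leNgt.
    by rewrite (Order.POrderTheory.le_trans a' b) (Order.POrderTheory.le_trans a b').
  rewrite negb_or -!Order.TotalTheory.leNgt => /andP[H1 H2].
  apply/(HK' _ _ ne).
  exists (Order.max (l' e) (l' e')); rewrite !interval.in_itv /=.
  rewrite !Order.TotalTheory.ge_max !Order.TotalTheory.le_max !Order.POrderTheory.lexx.
  by rewrite H1 H2 !le' /= orbT.
(* [rank] turns the real intervals into intervals of naturals at most n * n. *)
pose rank (x : R) := #|[set w : edge | (r' w < x)%R]|.
(* The edge e is counted at [l' e'] but not at [r' e], so the comparison stays strict. *)
have rank_lt e e' : (rank (r' e) < rank (l' e')) = (r' e < l' e')%R.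
  apply/idP/idP => [|H].
    apply: contraTT; rewrite -Order.TotalTheory.leNgt -leqNgt => H.
    apply: subset_leq_card; apply/subsetP => w; rewrite !inE => Hw.
    exact: Order.POrderTheory.lt_le_trans Hw H.
  apply: proper_card; apply/properP; split.
    apply/subsetP => w; rewrite !inE => Hw.
    exact: Order.POrderTheory.lt_trans Hw H.
  by exists e; rewrite !inE ?H // Order.POrderTheory.ltxx.
have rank_le x : rank x <= n * n by apply: leq_trans (max_card _) card_edge_le.
pose l0 := dart_val (fun e => rank (l' e)); pose r0 := dart_val (fun e => rank (r' e)).
have disj0 e e' (i j k h : 'I_n) : val e = [set i; j] -> val e' = [set k; h] ->
    disj l0 r0 i j k h = dj e e'.
  by move=> He He'; rewrite /disj /l0 /r0 !(dart_valE _ He) !(dart_valE _ He') !rank_lt.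
have edge_of (i j : 'I_n) : G i j -> exists e : edge, val e = [set i; j].
  by move=> Gij; have H : [set i; j] \in edges G; [rewrite edgesE|exists (exist _ [set i; j] H)].
have [] := @candidate_dominates n E Esym Eirr Eltn l0 r0.
- exact: dart_val_sym.
- exact: dart_val_sym.
- move=> i j /nadjP[i' [j' [-> -> /edge_of[e He]]]].
  rewrite /l0 /r0 !(dart_valE _ He); apply: subset_leq_card; apply/subsetP => w.
  by rewrite !inE => Hw; apply: Order.POrderTheory.lt_le_trans Hw (le' e).
- move=> i j k h /nadjP[i' [j' [-> -> /edge_of[e He]]]] /nadjP[k' [h' [-> -> /edge_of[e' He']]]].
  rewrite (disj0 _ _ _ _ _ _ He He') meet_set -He -He'; apply: contraTT; rewrite negbK => M.
  have ne : e != e'.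
    apply: contraTneq M => <-; rewrite setIid He; apply/set0Pn; exists i'.
    by rewrite !inE eqxx.
  by have := Hc _ _ (compl_line_disjoint ne M); rewrite K'E ne.
- by move=> i j; apply: dart_val_le => e; apply: rank_le.
- by move=> i j; apply: dart_val_le => e; apply: rank_le.
move=> p [pB pV pC].
have [x xT xd] := @digit_encoding (base n) 56 p pB.
have elo i j : lo n (digit n x) i j = lo n p i j by apply: lo_ext => k Hk; apply: xd.
have ehi i j : hi n (digit n x) i j = hi n p i j by apply: hi_ext => k Hk; apply: xd.
have Vx : valid E (lo n (digit n x)) (hi n (digit n x)).
  by move=> i j k h Ei Ek; rewrite /disj !elo !ehi; apply: pV.
have Cx : disj_count n E (lo n (digit n x)) (hi n (digit n x)) = disj_count n E (lo n p) (hi n p).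
  by apply: eq_bigr => d _; apply: eq_bigr => d' _; rewrite /disj !elo !ehi.
have := cmax x xT; rewrite scoreE // (scoreE c V) ltnS Cx => best_ge.
have := leq_trans pC best_ge.
rewrite {1}/disj_count (@sum_darts2 n G (disj l0 r0) dj); last exact: disj0.
rewrite disj_count_edges // leq_pmul2l //.
(* Both graphs satisfy the same identity, so at least as many disjoint pairs means at most as many
   edges. *)
have A1 := @card_edges_disj n G (overlap_graph G l r) (edge_disj (G := G) l r) (fun _ _ => erefl).
have A2 := @card_edges_disj n G K' dj K'E.
move=> H; rewrite -(leq_pmul2l (isT : 0 < 2)) -(leq_add2r (\sum_e \sum_e' dj e e')).
rewrite -(leq_add2r #|edge|) A2; last first.
  by move=> e; rewrite /dj orbb -Order.TotalTheory.leNgt.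
rewrite -A1 ?leq_add2r ?leq_add2l // => e.
by rewrite /edge_disj orbb -leqNgt; apply: ler.
Qed.

End Optimality.

(** * Input, output and the final program *)

Lemma init_memE n (G : sgraph 'I_n) (i j : 'I_n) : Defs.mem (init G) (i * n + j) = G i j.
Proof.
rewrite /=; congr nat_of_bool; apply/existsP/idP => [[k /existsP[h /andP[/eqP e H]]]|H].
  have n0 : 0 < n := leq_ltn_trans (leq0n i) (ltn_ord i).
  have ek : k = i.
    apply: val_inj; have := congr1 (divn^~ n) e.
    by rewrite !divnMDl // !divn_small // !addn0.
  have eh : h = j.
    by apply: val_inj; have := congr1 (modn^~ n) e; rewrite !modnMDl !modn_small.
  by rewrite -ek -eh.
by exists i; apply/existsP; exists j; rewrite eqxx.
Qed.

Lemma output_index n m (i j k h : 'I_n) :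
  output n m (((i * n + j) * n + k) * n + h) =
  ~~ same i j k h && ~~ cdisj n (best n m) i j k h.
Proof.
have n0 : 0 < n := leq_ltn_trans (leq0n i) (ltn_ord i).
have D x (y : 'I_n) : (x * n + y) %/ n = x by rewrite divnMDl // divn_small // addn0.
have M x (y : 'I_n) : (x * n + y) %% n = y by rewrite modnMDl modn_small.
rewrite /output; cbv zeta.
rewrite (expnS n 2) (expnS n 1) expn1 !divnMA !D !M.
by rewrite (modn_small (ltn_ord i)).
Qed.

(** All writes go beyond the input matrix, so by [output_ext] each value is the one computed from
    the initial memory. *)
Lemma fill_output_mem addr val n m :
  (forall i m', eval addr (scons i (fun=> n)) m' = n * n + i) ->
  (forall i m', eval val (scons i (fun=> n)) m' = output n m' i) ->
  forall i a, fill_mem addr val (fun=> n) m i a =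
    if n * n <= a < n * n + i then output n m (a - n * n) : nat else m a.
Proof.
move=> Ha Hv; elim=> [|i IH] a /=; first by rewrite addn0; case: leqP.
rewrite /upd Ha Hv; case: eqP => [->|ne].
  rewrite leq_addr addnS ltnSn addKn (@output_ext _ _ m) // => k h Hk Hh.
  by rewrite IH leqNgt (_ : k * n + h < n * n) //; move: Hk Hh; clear; nia.
rewrite IH; congr (if _ then _ else _); move: ne; clear; lia.
Qed.

Theorem theorem2 :
  exists (P : program) (q : {poly nat}),
    forall (R : realType) (n : nat) (G : sgraph 'I_n),
      exists t : nat,
        let c := iter t (step P) (init G) in
        [/\ (t <= (q.[n])%R)%N,
            halted P c
          & exists K : sgraph (edge_type G),
              min_interval_completion R (compl_graph (line_graph G)) K
              /\ returns c K].
Proof.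
(* In [bound] every variable is n; in [addr] and [val] variable 0 is the loop index and variable 1
   is n. *)
have [bound Hb] := computable_exp 4 (computable_var 0).
have [addr Ha] :=
  computable_add (computable_mul (computable_var 1) (computable_var 1)) (computable_var 0).
have [val Hv] := computable_output (computable_var 1) (computable_var 0).
have [k Hk] := fill_cost_poly bound addr val.
exists (fill_prog bound addr val), (('X + 3%:P) ^+ k)%R => R n G.
set m := Defs.mem (init G); set v : nat -> nat := fun=> n.
exists (fill_cost bound addr val v m) => /=.
have M := @fill_output_mem addr val n m (fun i m' => Ha _ _) (fun i m' => Hv _ _).
have m1 a : m a <= 1 by rewrite leq_b1.
have [g Hg] := fill_correct bound addr val (reg (init G)) m.
have -> : init G = Config 0 (reg (init G)) m by [].
rewrite Hg /=; split.
- rewrite horner_exp_comm; last exact: GRing.mulrC.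
  rewrite hornerD hornerX hornerC.
  change (fill_cost bound addr val v m <= (n + 3) ^ k); apply: Hk => // i Hi a; rewrite M;
    case: ifP => // _; exact: leq_b1.
- exact: leqnn.
- have Hm := init_memE G.
  exists (overlap_graph G (lo n (digit n (best n m))) (hi n (digit n (best n m)))); split.
    exact: best_candidate_optimal.
  move=> e f i j k' h He Hf /=.
  rewrite M Hb.
  rewrite (_ : (_ <= _ < _) = true) ?addKn.
    rewrite output_index; congr nat_of_bool; rewrite /overlap /=.
    rewrite same_set -He -Hf; congr (~~ _ && ~~ _).
    apply: edge_disjE => //; [exact: lo_sym|exact: hi_sym].
  have le3 (x N : nat) (y : 'I_n) : x < N -> x * n + y < N * n.
    by have := ltn_ord y; clear; nia.
  by rewrite leq_addr ltn_add2l !expnSr !mul1n (le3 _ _ _ (le3 _ _ _ (le3 _ _ _ (ltn_ord i)))).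
Qed.
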